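(* Let $S$ be an Enoki surface with $b_2(S)=n$ and let $D$ be its maximal reduced divisor of rational curves. Then the forms $$\omega_{f,c}=\sqrt{-1}\,f\,\zeta\wedge\bar\zeta+\sqrt{-1}\,c\,\Lambda\,\eta\wedge\bar\eta,$$ with $f$ smooth and positive on $A:=S\setminus D$ and $c>0$ a constant, define smooth Hermitian metrics on $S\setminus D$ which are flat along the leaves of the canonical foliation, and complete whenever $\inf_Af>0$. For the choice $$f=a-\frac{n}{2\log|\alpha|}\,c\,\Lambda|\tilde w|^2,\qquad a>0,$$ the metric $\omega_{f,c}$ is in addition Gauduchon, i.e. $\partial\overline\partial\omega_{f,c}=0$.
   Context: Enoki surfaces. An Enoki surface is a minimal compact complex surface with $b_1=1$, Kodaira dimension $-\infty$, $b_2(S)=n>0$, whose maximal reduced divisor of rational curves $D$ is homologically trivial with $D^2=0$. By Enoki's theorem $A=S\setminus D$ is (and is identified with) the quotient of $\mathbb C^*\times\mathbb C$, with coordinates $(z,w)$, by the group generated by $F(z,w)=(\alpha z,\,z^nw+P(z))$, with $\alpha\in\mathbb C$, $0<|\alpha|<1$, and $P$ a polynomial of degree at most $n$. The projection $(z,w)\mapsto z$ induces an affine bundle $\pi:A\to E=\mathbb C^*/\langle z\mapsto\alpha z\rangle$; the canonical foliation on $A$ is the kernel of $\zeta$ and its leaves are the fibres of $\pi$. A Hermitian metric is flat along the leaves if its restriction to every leaf is flat. Set $\zeta:=dz/z$. Fix a smooth function $s:\mathbb C^*\to\mathbb C$ with $s(\alpha z)=z^ns(z)-P(z)$ and set $$\tilde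 w:=w+s(z),\quad q(\sigma):=n\sigma-\frac{n}{\log|\alpha|}\sigma^2,\quad \Lambda:=e^{q(\log|z|)},$$ $$\eta:=dw+\Big(\frac{\partial s}{\partial z}+\frac{q'(\log|z|)}{2z}\,\tilde w\Big)dz .$$ Forms and functions on $A$ are identified with $F$-invariant ones on $\mathbb C^*\times\mathbb C$. *)

(* Defs.v *)
From Stdlib Require Import Reals.
From Coquelicot Require Import Coquelicot.
Open Scope R_scope.

(** * Calculus of complex-valued functions on an open set of a complex normed space *)

Section Calculus.
Context {V : NormedModule C_AbsRing}.

Definition on_line (g : V -> C) (v p : V) (t : R) : C :=
  g (plus p (scal (RtoC t) v)).

(* Real directional derivative.  Coquelicot's [Derive] is real-valued, hence the
   two components; the value is meaningful under [ex_dderiv]. *)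
Definition dderiv (g : V -> C) (v p : V) : C :=
  (Derive (fun t : R => Re (on_line g v p t)) 0,
   Derive (fun t : R => Im (on_line g v p t)) 0).

Definition ex_dderiv (g : V -> C) (v p : V) : Prop :=
  ex_derive (K := R_AbsRing) (V := C_R_NormedModule) (on_line g v p) 0.

(* Class C^k in the real sense on the open set [U]: the iterated directional
   derivatives of order at most [k] exist and are continuous. *)
Fixpoint Ck_on (U : V -> Prop) (k : nat) (g : V -> C) : Prop :=
  (forall p, U p -> continuous g p) /\
  match k with
  | O => True
  | S j => forall v : V,
      (forall p, U p -> ex_dderiv g v p) /\ Ck_on U j (dderiv g v)
  end.

Definition smooth_on (U : V -> Prop) (g : V -> C) : Prop :=
  forall k : nat, Ck_on U k g.

(* The derivatives along the (1,0) and (0,1) parts of the real tangent vector [v]: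
   [d10 g v] is the sum of the v_j dg/dz_j, and [d01 g v] that of the
   conj(v_j) dg/dconj(z_j). *)
Definition d10 (g : V -> C) (v p : V) : C :=
  ((dderiv g v p - Ci * dderiv g (scal Ci v) p) / 2)%C.

Definition d01 (g : V -> C) (v p : V) : C :=
  ((dderiv g v p + Ci * dderiv g (scal Ci v) p) / 2)%C.

End Calculus.

(** * Differential forms on open sets of C^2 *)

(* A form of degree k sends a point and k real tangent vectors to a complex number. *)
Definition Form1 : Type := C * C -> C * C -> C.
Definition Form2 : Type := C * C -> C * C -> C * C -> C.
Definition Form3 : Type := C * C -> C * C -> C * C -> C * C -> C.
Definition Form4 : Type := C * C -> C * C -> C * C -> C * C -> C * C -> C.

Definition mulI (v : C * C) : C * C := ((Ci * fst v)%C, (Ci * snd v)%C).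

Definition dz : Form1 := fun _ v => fst v.
Definition dw : Form1 := fun _ v => snd v.

Definition conj_form (a : Form1) : Form1 := fun p u => Cconj (a p u).

Definition wedge (a b : Form1) : Form2 :=
  fun p u v => (a p u * b p v - a p v * b p u)%C.

(* As for the exterior derivative, evaluated on constant vector fields; keeping only
   the (1,0), resp. (0,1), derivatives of the coefficients gives del, resp. delbar. *)
Definition delbar (om : Form2) : Form3 := fun p u0 u1 u2 =>
  (d01 (fun x => om x u1 u2) u0 p - d01 (fun x => om x u0 u2) u1 p
   + d01 (fun x => om x u0 u1) u2 p)%C.

Definition del (th : Form3) : Form4 := fun p u0 u1 u2 u3 =>
  (d10 (fun x => th x u1 u2 u3) u0 p - d10 (fun x => th x u0 u2 u3) u1 p
   + d10 (fun x => th x u0 u1 u3) u2 p - d10 (fun x => th x u0 u1 u2) u3 p)%C.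

Definition pullback (F : C * C -> C * C) (om : Form2) : Form2 := fun p u v =>
  let dF x := (dderiv (fun q => fst (F q)) x p, dderiv (fun q => snd (F q)) x p) in
  om (F p) (dF u) (dF v).

(** * The surface A = (C^* x C) / <F> *)

Definition Cstar (z : C) : Prop := z <> RtoC 0.

Definition cover (p : C * C) : Prop := Cstar (fst p).

Definition polynomial_of_degree_at_most (n : nat) (P : C -> C) : Prop :=
  exists a : nat -> C, forall z : C, P z = sum_n (fun k => (a k * z ^ k)%C) n.

Definition deck (n : nat) (alpha : C) (P : C -> C) (p : C * C) : C * C :=
  ((alpha * fst p)%C, (fst p ^ n * snd p + P (fst p))%C).

Definition same_orbit (F : C * C -> C * C) (p q : C * C) : Prop :=
  exists k : nat, Nat.iter k F p = q \/ Nat.iter k F q = p.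

(* Functions and forms on A are the F-invariant ones on C^* x C. *)
Definition positive_smooth_on_A (F : C * C -> C * C) (f : C * C -> R) : Prop :=
  smooth_on cover (fun p => RtoC (f p)) /\
  (forall p, cover p -> 0 < f p) /\
  (forall p, cover p -> f (F p) = f p).

Definition inf_A (f : C * C -> R) : Rbar :=
  Glb_Rbar (fun y => exists p, cover p /\ y = f p).

(* A Hermitian metric, given by its fundamental form: a smooth real (1,1)-form [om]
   such that u |-> om(u, Iu) is positive definite. *)
Definition hermitian_metric_on_A (F : C * C -> C * C) (om : Form2) : Prop :=
  (forall u v, smooth_on cover (fun p => om p u v)) /\
  (forall p, cover p -> forall u v,
     om p v u = (- om p u v)%C /\
     Im (om p u v) = 0 /\
     om p (mulI u) (mulI v) = om p u v /\
     (forall u', om p (plus u u') v = (om p u v + om p u' v)%C) /\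
     (forall t : R, om p (scal (RtoC t) u) v = (RtoC t * om p u v)%C)) /\
  (forall p, cover p -> forall u, u <> (RtoC 0, RtoC 0) ->
     0 < Re (om p u (mulI u))) /\
  (forall p, cover p -> forall u v, pullback F om p u v = om p u v).

(* Gaussian curvature of the metric h (dx^2 + dy^2) on C at x + iy. *)
Definition conformal_curvature (h : C -> R) (w : C) : R :=
  - (Derive_n (fun x => ln (h (x, Im w))) 2 (Re w)
     + Derive_n (fun y => ln (h (Re w, y))) 2 (Im w)) / (2 * h w).

(* The leaves of the canonical foliation are the images in A of the {z} x C, on each
   of which the projection to A is injective. *)
Definition leaf_metric (om : Form2) (z w : C) : R :=
  Re (om (z, w) (RtoC 0, RtoC 1) (RtoC 0, Ci)).

Definition flat_along_leaves (om : Form2) : Prop :=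
  forall z w : C, Cstar z -> conformal_curvature (leaf_metric om z) w = 0.

Definition gauduchon (om : Form2) : Prop :=
  forall p, cover p -> forall u0 u1 u2 u3,
    del (delbar om) p u0 u1 u2 u3 = RtoC 0.

(** ** Completeness *)

Definition C1_arc (g dg : R -> C * C) : Prop :=
  (forall t : R,
     is_derive (V := prod_NormedModule R_AbsRing C_R_NormedModule C_R_NormedModule)
       g t (dg t)) /\
  (forall t : R, continuous dg t) /\
  (forall t : R, 0 <= t <= 1 -> cover (g t)).

Definition arc_length (om : Form2) (g dg : R -> C * C) : R :=
  RInt (fun t => sqrt (Re (om (g t) (dg t) (mulI (dg t))))) 0 1.

(* [joined om p q l]: a piecewise C^1 curve of length [l] in C^* x C, from p to q. *)
Inductive joined (om : Form2) : C * C -> C * C -> R -> Prop :=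
| joined_refl : forall p, cover p -> joined om p p 0
| joined_step : forall (g dg : R -> C * C) (q : C * C) (l : R),
    C1_arc g dg -> joined om (g 1) q l ->
    joined om (g 0) q (arc_length om g dg + l).

(* Distance in A between the classes of p and q: since C^* x C -> A is a covering,
   the curves in A are the images of those upstairs. *)
Definition dist_A (F : C * C -> C * C) (om : Form2) (p q : C * C) : Rbar :=
  Glb_Rbar (fun l => exists p' q',
    same_orbit F p p' /\ same_orbit F q q' /\ joined om p' q' l).

Definition complete_on_A (F : C * C -> C * C) (om : Form2) : Prop :=
  forall x : nat -> C * C,
    (forall k, cover (x k)) ->
    (forall eps : R, 0 < eps -> exists N : nat, forall j k : nat,
       (N <= j)%nat -> (N <= k)%nat -> Rbar_lt (dist_A F om (x j) (x k)) eps) ->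
    exists p, cover p /\
      forall eps : R, 0 < eps -> exists N : nat, forall k : nat,
        (N <= k)%nat -> Rbar_lt (dist_A F om (x k) p) eps.

(** * The forms omega_(f,c) *)

Definition zeta : Form1 := fun p v => (dz p v / fst p)%C.

Definition wtilde (s : C -> C) (p : C * C) : C := (snd p + s (fst p))%C.

Definition qfun (n : nat) (alpha : C) (sigma : R) : R :=
  INR n * sigma - INR n / ln (Cmod alpha) * sigma ^ 2.

Definition Lambda (n : nat) (alpha : C) (p : C * C) : R :=
  exp (qfun n alpha (ln (Cmod (fst p)))).

Definition eta (n : nat) (alpha : C) (s : C -> C) : Form1 := fun p v =>
  (dw p v
   + (d10 s (RtoC 1) (fst p)
      + RtoC (Derive (qfun n alpha) (ln (Cmod (fst p)))) / (2 * fst p) * wtilde s p)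
     * dz p v)%C.

Definition omega (n : nat) (alpha : C) (s : C -> C) (f : C * C -> R) (c : R) : Form2 :=
  fun p u v =>
    (Ci * RtoC (f p) * wedge zeta (conj_form zeta) p u v
     + Ci * RtoC c * RtoC (Lambda n alpha p)
       * wedge (eta n alpha s) (conj_form (eta n alpha s)) p u v)%C.

Definition gauduchon_f (n : nat) (alpha : C) (s : C -> C) (a c : R) (p : C * C) : R :=
  a - INR n / (2 * ln (Cmod alpha)) * c * Lambda n alpha p * Cmod (wtilde s p) ^ 2.

(* Main.v *)
(* The section [wtilde] of the line bundle with Hermitian metric [Lambda] satisfies
   [F^* Lambda = |z|^(-2n) Lambda], [F^* wtilde = z^n wtilde] and [F^* eta = z^n eta], so
   [omega] descends to A; on a leaf, [eta] restricts to [dw] and [Lambda] to a constant.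

   Completeness: [eta = Lambda^(-1) del(Lambda wtilde)] is the (1,0) part of the Chern
   derivative of [wtilde], while the norm of its (0,1) part relative to [zeta] is
   [Lambda^(1/2) |z ds/dz_bar|], an invariant function of [z], bounded by compactness of
   E. If [inf f > 0], then [sqrt (1 + Lambda |wtilde|^2)] is Lipschitz for the distance;
   it is proper on A, so Cauchy sequences stay in a compact set.

   Gauduchon: [del delbar] of the two summands of [omega] are opposite multiples of
   [dw /\ dw_bar /\ zeta /\ zeta_bar], since the second derivative of [q] is
   [- 2 n / log |alpha|]. *)

Require Import Defs.
From Stdlib Require Import Reals Lra Lia Arith Classical ClassicalChoice.
From Coquelicot Require Import Coquelicot.
Open Scope R_scope.

(** The operators [del] and [delbar] rest on real directional derivatives, and [Ck_on] says nothing
    about linearity in the direction. Linearity has to be earned: continuous partials give total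
    differentiability, hence a chain rule, hence the splitting of a derivative along [v] into a part
    in [v] and a part in [conj v]. From then on a function enters only through its (1,0) and (0,1)
    derivatives along [v], and the Gauduchon equation becomes a polynomial identity in such numbers.

    The shape of [f] answers the curvature of [Lambda]: because of [q''], [delbar eta] contains the
    coefficient [- n / (2 log|alpha|) |z|^(-2) wtilde]. Since [zeta /\ zeta_bar] absorbs [dz_bar],
    only the derivative of [f] in [w_bar] can compensate it, and integrating in [w_bar] gives the
    multiple of [Lambda |wtilde|^2] in [f].

    In the quotient the points of a Cauchy sequence may wander along their orbits. Compactness is
    therefore used on representatives over an annulus, and the curves found upstairs are glued by
    applying iterates of [F], which are isometries. *)

Lemma Ci_sqr : (Ci * Ci = - (1))%C.
Proof. apply injective_projections; simpl; ring. Qed.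

Lemma Cconj_Ci : Cconj Ci = (- Ci)%C.
Proof. apply injective_projections; simpl; ring. Qed.

Lemma Cconj_RtoC (r : R) : Cconj (RtoC r) = RtoC r.
Proof. apply injective_projections; simpl; ring. Qed.

Lemma Cconj_neq_0 (z : C) : z <> 0 -> Cconj z <> 0.
Proof. intros Hz E. apply Hz. now rewrite <- (Cconj_conj z), E, Cconj_RtoC. Qed.

(** * Derivatives of complex-valued functions of a real variable *)

Definition is_cderive (g : R -> C) (t : R) (l : C) : Prop :=
  is_derive (K := R_AbsRing) (V := C_R_NormedModule) g t l.

Lemma is_cderive_iff (g : R -> C) (t : R) (l : C) :
  is_cderive g t l <->
  is_derive (fun x => Re (g x)) t (Re l) /\ is_derive (fun x => Im (g x)) t (Im l).
Proof.
  split.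
  - intros H; split.
    + apply (filterdiff_comp (V := C_R_NormedModule) g fst (fun y => scal y l) fst).
      exact H.
      apply filterdiff_linear. apply (is_linear_fst (U := R_NormedModule) (V := R_NormedModule)).
    + apply (filterdiff_comp (V := C_R_NormedModule) g snd (fun y => scal y l) snd).
      exact H.
      apply filterdiff_linear. apply (is_linear_snd (U := R_NormedModule) (V := R_NormedModule)).
  - intros [H1 H2].
    apply (is_derive_ext
      (fun x => plus (scal (Re (g x)) ((1, 0) : C_R_NormedModule))
                     (scal (Im (g x)) ((0, 1) : C_R_NormedModule)))).
    + intros x. destruct (g x) as [a b].
      unfold plus, scal; simpl. unfold prod_plus, prod_scal, scal, plus; simpl.
      unfold mult; simpl. f_equal; ring.
    + replace l with (plus (scal (Re l) ((1, 0) : C_R_NormedModule))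
                     (scal (Im l) ((0, 1) : C_R_NormedModule))).
      apply @is_derive_plus; apply @is_derive_scal_l; assumption.
      destruct l as [a b].
      unfold plus, scal; simpl. unfold prod_plus, prod_scal, scal, plus; simpl.
      unfold mult; simpl. f_equal; ring.
Qed.

Lemma is_cderive_eq (g : R -> C) t (l l' : C) : is_cderive g t l -> l = l' -> is_cderive g t l'.
Proof. now intros H <-. Qed.

Lemma is_cderive_const (a : C) (t : R) : is_cderive (fun _ => a) t 0.
Proof.
  apply is_cderive_iff; split; apply (is_derive_const (V := R_NormedModule)).
Qed.

Lemma is_cderive_plus (g h : R -> C) t a b :
  is_cderive g t a -> is_cderive h t b -> is_cderive (fun x => g x + h x)%C t (a + b)%C.
Proof. exact (is_derive_plus (V := C_R_NormedModule) g h t a b). Qed.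

Lemma is_cderive_mult (g h : R -> C) t a b :
  is_cderive g t a -> is_cderive h t b ->
  is_cderive (fun x => g x * h x)%C t (a * h t + g t * b)%C.
Proof.
  rewrite !is_cderive_iff. intros [H1 H2] [H3 H4]. simpl.
  split.
  - evar_last.
    apply @is_derive_minus; apply @is_derive_mult; try eassumption; intros; apply Rmult_comm.
    unfold minus, plus, opp, mult; simpl. unfold Re, Im. ring.
  - evar_last.
    apply @is_derive_plus; apply @is_derive_mult; try eassumption; intros; apply Rmult_comm.
    unfold minus, plus, opp, mult; simpl. unfold Re, Im. ring.
Qed.

Lemma is_cderive_conj (g : R -> C) t a :
  is_cderive g t a -> is_cderive (fun x => Cconj (g x)) t (Cconj a).
Proof.
  rewrite !is_cderive_iff. intros [H1 H2]; split. exact H1.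
  exact (is_derive_opp (V := R_NormedModule) _ _ _ H2).
Qed.

Lemma is_cderive_RtoC (g : R -> R) t a :
  is_derive g t a -> is_cderive (fun x => RtoC (g x)) t (RtoC a).
Proof.
  rewrite is_cderive_iff. split; simpl. assumption. apply (is_derive_const (V := R_NormedModule)).
Qed.

Lemma Cmod_sqr (z : C) : (Cmod z ^ 2 = Re z * Re z + Im z * Im z)%R.
Proof. unfold Cmod. rewrite pow2_sqrt. simpl. unfold Re, Im. ring. simpl. nra. Qed.

Lemma Csqr_neq0 (z : C) : z <> 0 -> (0 < Re z * Re z + Im z * Im z)%R.
Proof.
  intros H. rewrite <- Cmod_sqr. apply pow_lt. now apply Cmod_gt_0.
Qed.

Lemma is_derive_normsq (u v : R -> R) t a b :
  is_derive u t a -> is_derive v t b ->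
  is_derive (fun x => u x ^ 2 + v x ^ 2) t (2 * (u t * a + v t * b)).
Proof.
  intros Hu Hv. evar_last.
  apply @is_derive_plus; apply is_derive_pow; eassumption.
  unfold plus; simpl. ring.
Qed.

Lemma is_cderive_inv (g : R -> C) t a :
  is_cderive g t a -> g t <> 0 -> is_cderive (fun x => / g x)%C t (- a * (/ g t * / g t))%C.
Proof.
  intros H Hn. pose proof (Csqr_neq0 _ Hn) as Hp.
  revert H. rewrite !is_cderive_iff. intros [H1 H2]. unfold Re, Im in *. simpl.
  split.
  - evar_last.
    apply is_derive_div; [apply H1| |].
    apply is_derive_normsq; eassumption.
    apply Rgt_not_eq; simpl; nra.
    unfold plus, mult; simpl. field; apply Rgt_not_eq; nra.
  - evar_last.
    apply is_derive_div; [apply @is_derive_opp, H2| |].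
    apply is_derive_normsq; eassumption.
    apply Rgt_not_eq; simpl; nra.
    unfold plus, mult, opp; simpl. field; apply Rgt_not_eq; nra.
Qed.

(** The real part of the logarithmic derivative; going through [ln], [sqrt] and the sum of squares
    avoids choosing a branch of the complex logarithm. *)
Lemma is_derive_lnmod (g : R -> C) t a :
  is_cderive g t a -> g t <> 0 -> is_derive (fun x => ln (Cmod (g x))) t (Re (a / g t)).
Proof.
  intros H Hn. pose proof (Csqr_neq0 _ Hn) as Hp.
  revert H. rewrite !is_cderive_iff. intros [H1 H2].
  unfold Re, Im in *.
  pose proof (is_derive_normsq _ _ _ _ _ H1 H2) as H3.
  assert (Hc : (0 < Cmod (g t))%R) by now apply Cmod_gt_0.
  assert (H4 : is_derive sqrt (fst (g t) ^ 2 + snd (g t) ^ 2)%R (/ (2 * Cmod (g t)))).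
  { unfold Cmod. auto_derive. simpl; nra. simpl; ring. }
  assert (H5 : is_derive ln (Cmod (g t)) (/ Cmod (g t))) by now apply is_derive_ln.
  evar_last.
  exact (is_derive_comp ln (fun x => Cmod (g x)) _ _ _ H5 (is_derive_comp sqrt _ _ _ _ H4 H3)).
  assert (H6 := Cmod_sqr (g t)).
  unfold scal; simpl; unfold mult; simpl.
  unfold Re, Im in *. simpl in H6 |- *.
  replace (fst (g t) * (fst (g t) * 1) + snd (g t) * (snd (g t) * 1))%R with (Cmod (g t)
    * Cmod (g t))%R by nra.
  field. apply Rgt_not_eq; nra.
Qed.

(** * Continuity of complex-valued functions *)

Lemma continuous_C_iff {U : UniformSpace} (g : U -> C) (x : U) :
  continuous g x <-> continuous (fun y => Re (g y)) x /\ continuous (fun y => Im (g y)) x.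
Proof.
  split.
  - intros H; split.
    + apply (continuous_comp g fst). exact H. destruct (g x). apply continuous_fst.
    + apply (continuous_comp g snd). exact H. destruct (g x). apply continuous_snd.
  - intros [H1 H2] P [eps HP].
    destruct (proj1 (filterlim_locally _ _) H1 eps) as [d1 Hd1].
    destruct (proj1 (filterlim_locally _ _) H2 eps) as [d2 Hd2].
    exists (mkposreal _ (Rmin_stable_in_posreal d1 d2)). intros y Hy.
    apply HP. split.
    apply Hd1. eapply ball_le; [|exact Hy]. apply Rmin_l.
    apply Hd2. eapply ball_le; [|exact Hy]. apply Rmin_r.
Qed.

Lemma continuous_Cplus {U : UniformSpace} (g h : U -> C) x :
  continuous g x -> continuous h x -> continuous (fun y => g y + h y)%C x.
Proof. exact (continuous_plus (V := C_R_NormedModule) g h x). Qed.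

Lemma continuous_Rmult {U : UniformSpace} (g h : U -> R) x :
  continuous g x -> continuous h x -> continuous (fun y => g y * h y)%R x.
Proof. exact (continuous_mult (K := R_AbsRing) g h x). Qed.

Lemma continuous_Rplus {U : UniformSpace} (g h : U -> R) x :
  continuous g x -> continuous h x -> continuous (fun y => g y + h y)%R x.
Proof. exact (continuous_plus (V := R_NormedModule) g h x). Qed.

Lemma continuous_Rminus {U : UniformSpace} (g h : U -> R) x :
  continuous g x -> continuous h x -> continuous (fun y => g y - h y)%R x.
Proof. exact (continuous_minus (V := R_NormedModule) g h x). Qed.

Lemma continuous_Cmult {U : UniformSpace} (g h : U -> C) x :
  continuous g x -> continuous h x -> continuous (fun y => g y * h y)%C x.
Proof.
  rewrite !continuous_C_iff. intros [H1 H2] [H3 H4]; split; simpl.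
  - apply continuous_Rminus; now apply continuous_Rmult.
  - apply continuous_Rplus; now apply continuous_Rmult.
Qed.

Lemma continuous_Cconj {U : UniformSpace} (g : U -> C) x :
  continuous g x -> continuous (fun y => Cconj (g y)) x.
Proof.
  rewrite !continuous_C_iff. intros [H1 H2]; split; simpl. exact H1.
  exact (continuous_opp (V := R_NormedModule) _ _ H2).
Qed.

Lemma continuous_RtoC {U : UniformSpace} (g : U -> R) x :
  continuous (fun y => RtoC (g y)) x <-> continuous g x.
Proof.
  rewrite continuous_C_iff; simpl. split. intros [H _]; exact H.
  split. assumption. apply continuous_const.
Qed.

Lemma continuous_Rcomp {U : UniformSpace} (f : R -> R) (g : U -> R) x l :
  is_derive f (g x) l -> continuous g x -> continuous (fun y => f (g y)) x.
Proof.
  intros Hf Hg. apply (continuous_comp g f). exact Hg.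
  apply (ex_derive_continuous (V := R_NormedModule)). now exists l.
Qed.

Lemma continuous_normsq {U : UniformSpace} (g : U -> C) x :
  continuous g x -> continuous (fun y => Re (g y) * Re (g y) + Im (g y) * Im (g y))%R x.
Proof.
  intros H. apply continuous_C_iff in H as [H1 H2].
  apply continuous_Rplus; now apply continuous_Rmult.
Qed.

Lemma continuous_Cinv {U : UniformSpace} (g : U -> C) x :
  continuous g x -> g x <> 0 -> continuous (fun y => / g y)%C x.
Proof.
  intros H Hn. pose proof (Csqr_neq0 _ Hn) as Hp.
  pose proof (continuous_normsq _ _ H) as H0.
  assert (H3 : continuous (fun y => / (Re (g y) * Re (g y) + Im (g y) * Im (g y)))%R x).
  { eapply (continuous_Rcomp Rinv). auto_derive. now apply Rgt_not_eq. reflexivity. exact H0. }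
  apply continuous_C_iff in H as [H1 H2].
  apply continuous_C_iff; split; simpl; unfold Rdiv.
  - apply continuous_Rmult. exact H1.
    eapply continuous_ext; [|exact H3]. intros y; simpl; f_equal; unfold Re, Im; ring.
  - apply continuous_Rmult. exact (continuous_opp (V := R_NormedModule) _ _ H2).
    eapply continuous_ext; [|exact H3]. intros y; simpl; f_equal; unfold Re, Im; ring.
Qed.

Lemma continuous_Cmod {U : UniformSpace} (g : U -> C) x :
  continuous g x -> continuous (fun y => Cmod (g y)) x.
Proof.
  intros H. unfold Cmod. apply (continuous_comp _ sqrt).
  - eapply continuous_ext; [|exact (continuous_normsq _ _ H)].
    intros y; simpl; unfold Re, Im; ring.
  - apply continuity_pt_filterlim. apply continuity_pt_sqrt. nra.
Qed.

Lemma continuous_Cmod_sqr {U : UniformSpace} (g : U -> C) x :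
  continuous g x -> continuous (fun y => Cmod (g y) ^ 2) x.
Proof.
  intros H. apply continuous_ext with (fun y => Cmod (g y) * Cmod (g y)).
  - intros; simpl; ring.
  - apply continuous_Rmult; now apply continuous_Cmod.
Qed.

Lemma continuous_lnmod {U : UniformSpace} (g : U -> C) x :
  continuous g x -> g x <> 0 -> continuous (fun y => ln (Cmod (g y))) x.
Proof.
  intros H Hn. eapply (continuous_Rcomp ln). apply is_derive_ln. now apply Cmod_gt_0.
  now apply continuous_Cmod.
Qed.

Lemma continuous_exp {U : UniformSpace} (g : U -> R) x :
  continuous g x -> continuous (fun y => exp (g y)) x.
Proof. intros H. eapply (continuous_Rcomp exp). apply is_derive_exp. exact H. Qed.

Lemma continuous_Cpow {U : UniformSpace} (g : U -> C) (k : nat) x :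
  continuous g x -> continuous (fun y => g y ^ k)%C x.
Proof.
  intros Hg. induction k as [|k IH]. apply continuous_const. now apply continuous_Cmult.
Qed.

(** * Directional derivatives and smoothness *)

Definition is_dderiv {V : NormedModule C_AbsRing} (g : V -> C) (v p : V) (l : C) : Prop :=
  is_cderive (on_line g v p) 0 l.

Section DirectionalDerivatives.
Context {V : NormedModule C_AbsRing}.
Implicit Types (g h : V -> C) (p v : V) (U : V -> Prop).

Lemma on_line_0 g v p : on_line g v p 0 = g p.
Proof.
  unfold on_line. replace (RtoC 0) with (@zero C_AbsRing) by reflexivity.
  now rewrite (scal_zero_l (K := C_AbsRing)), plus_zero_r.
Qed.

Lemma dderiv_unique g v p l : is_dderiv g v p l -> dderiv g v p = l.
Proof.
  intros [H1 H2]%is_cderive_iff. apply injective_projections; simpl.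
  exact (is_derive_unique _ _ _ H1). exact (is_derive_unique _ _ _ H2).
Qed.

Lemma dderiv_correct g v p : ex_dderiv g v p -> is_dderiv g v p (dderiv g v p).
Proof.
  intros [l Hl]. now rewrite (dderiv_unique g v p l).
Qed.

Lemma locally_line U v p :
  open U -> U p -> locally 0 (fun t : R => U (plus p (scal (RtoC t) v))).
Proof.
  intros HU Hp.
  assert (Hc : continuous (fun t : R => plus p (scal (RtoC t) v)) 0).
  { apply continuous_plus. apply continuous_const.
    apply (continuous_scal (K := C_AbsRing) (fun t : R => RtoC t : C_AbsRing)).
    2: apply continuous_const.
    assert (H : continuous (fun t : R => RtoC t) 0) by apply continuous_RtoC, continuous_id.
    (* As an absolute ring [C] has the balls of the modulus, as a product it has boxes; [locally_C]
       identifies the two kinds of neighbourhoods. *)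
    intros P HP. apply H. now apply locally_C. }
  apply Hc. apply HU.
  replace (RtoC 0) with (@zero C_AbsRing) by reflexivity.
  now rewrite (scal_zero_l (K := C_AbsRing)), plus_zero_r.
Qed.

Lemma is_dderiv_ext U g h v p l :
  open U -> U p -> (forall q, U q -> g q = h q) -> is_dderiv g v p l -> is_dderiv h v p l.
Proof.
  intros HU Hp Hgh. apply (is_derive_ext_loc (V := C_R_NormedModule)).
  eapply filter_imp; [|apply (locally_line U v p HU Hp)]. intros t; apply Hgh.
Qed.

Lemma is_dderiv_const (a : C) v p : is_dderiv (fun _ => a) v p 0.
Proof. apply is_cderive_const. Qed.

Lemma is_dderiv_plus g h v p a b :
  is_dderiv g v p a -> is_dderiv h v p b -> is_dderiv (fun x => g x + h x)%C v p (a + b)%C.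
Proof. apply is_cderive_plus. Qed.

Lemma is_dderiv_mult g h v p a b :
  is_dderiv g v p a -> is_dderiv h v p b ->
  is_dderiv (fun x => g x * h x)%C v p (a * h p + g p * b)%C.
Proof.
  intros Hg Hh. pose proof (is_cderive_mult _ _ _ _ _ Hg Hh) as H.
  now rewrite !on_line_0 in H.
Qed.

Lemma is_dderiv_conj g v p a :
  is_dderiv g v p a -> is_dderiv (fun x => Cconj (g x)) v p (Cconj a).
Proof. apply is_cderive_conj. Qed.

Lemma is_dderiv_inv g v p a :
  is_dderiv g v p a -> g p <> 0 ->
  is_dderiv (fun x => / g x)%C v p (- a * (/ g p * / g p))%C.
Proof.
  intros Hg Hn. rewrite <- (on_line_0 g v p) in Hn |- *.
  exact (is_cderive_inv _ _ _ Hg Hn).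
Qed.

Lemma is_dderiv_lnmod g v p a :
  is_dderiv g v p a -> g p <> 0 ->
  is_dderiv (fun x => RtoC (ln (Cmod (g x)))) v p
    ((a * / g p + Cconj (a * / g p)) * / 2)%C.
Proof.
  intros Hg Hn. rewrite <- (on_line_0 g v p) in Hn |- *.
  replace (_ * / 2)%C with (RtoC (Re (a / on_line g v p 0))) by (rewrite re_alt; reflexivity).
  apply is_cderive_RtoC, is_derive_lnmod; assumption.
Qed.

Lemma is_dderiv_exp (g : V -> R) v p a :
  is_dderiv (fun x => RtoC (g x)) v p a ->
  is_dderiv (fun x => RtoC (exp (g x))) v p (RtoC (exp (g p)) * a)%C.
Proof.
  intros [H1 H2]%is_cderive_iff.
  (* The imaginary part of a real-valued function is the constant 0, so its derivative is real and
     the real chain rule for [exp] applies. *)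
  assert (Ha : a = RtoC (Re a)).
  { apply injective_projections. reflexivity.
    transitivity (Derive (fun _ => 0) 0); [|apply Derive_const].
    symmetry. exact (is_derive_unique _ _ _ H2). }
  rewrite Ha, <- RtoC_mult. apply is_cderive_RtoC.
  evar_last.
  apply (is_derive_comp exp). apply is_derive_exp. exact H1.
  unfold scal; simpl; unfold mult; simpl.
  rewrite Rmult_comm. f_equal. f_equal.
  exact (f_equal Re (on_line_0 (fun x => RtoC (g x)) v p)).
Qed.

(** Near a point of the open set [U] a line stays in [U], so agreement on [U] passes to the
    directional derivatives and then, by induction, to every order. *)
Lemma Ck_ext U k g h :
  open U -> (forall q, U q -> g q = h q) -> Ck_on U k g -> Ck_on U k h.
Proof.
  intros HU. revert g h. induction k as [|k IH]; intros g h Hgh [Hc Hk]; split; trivial.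
  1, 2: intros p Hp; eapply continuous_ext_loc; [|now apply Hc];
    eapply filter_imp; [|exact (HU p Hp)]; apply Hgh.
  intros v. destruct (Hk v) as [He Hd].
  assert (H : forall p, U p -> is_dderiv h v p (dderiv g v p)).
  { intros p Hp. apply (is_dderiv_ext U g); trivial. now apply dderiv_correct, He. }
  split.
  - intros p Hp. eexists. now apply H.
  - apply (IH (dderiv g v)); [|exact Hd]. intros q Hq. symmetry. now apply dderiv_unique, H.
Qed.

(** [Ck_on] recurses on the function [dderiv g v], defined on all of [V]. Here any formula that
    equals it on [U] may take its place, so that the closure lemmas recurse on the Leibniz and
    quotient rules. *)
Lemma Ck_intro U k g (g' : V -> V -> C) :
  open U -> (forall p, U p -> continuous g p) ->
  (forall v p, U p -> is_dderiv g v p (g' v p)) ->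
  (forall v, Ck_on U k (g' v)) -> Ck_on U (S k) g.
Proof.
  intros HU Hc Hd Hk; split. exact Hc.
  intros v; split.
  - intros p Hp. eexists. now apply Hd.
  - apply (Ck_ext U k (g' v)); trivial.
    intros q Hq. symmetry. now apply dderiv_unique, Hd.
Qed.

Lemma Ck_continuous U k g p : Ck_on U k g -> U p -> continuous g p.
Proof. destruct k; intros [H _]; apply H. Qed.

Lemma Ck_dderiv U k g v p :
  Ck_on U (S k) g -> U p -> is_dderiv g v p (dderiv g v p).
Proof. intros [_ H] Hp. now apply dderiv_correct, H. Qed.

Lemma Ck_derivative U k g v : Ck_on U (S k) g -> Ck_on U k (dderiv g v).
Proof. intros [_ H]. apply H. Qed.

Lemma Ck_pred U k g : Ck_on U (S k) g -> Ck_on U k g.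
Proof.
  revert g; induction k as [|k IH]; intros g [Hc H]; split; trivial.
  intros v. destruct (H v) as [H1 H2]. split. exact H1. now apply IH.
Qed.

Lemma Ck_const U k (a : C) : open U -> Ck_on U k (fun _ => a).
Proof.
  intros HU. revert a; induction k as [|k IH]; intros a.
  - split; trivial. intros p _. apply continuous_const.
  - apply Ck_intro with (fun _ _ => RtoC 0); trivial.
    intros; apply continuous_const. intros; apply is_dderiv_const.
Qed.

Lemma Ck_plus U k g h :
  open U -> Ck_on U k g -> Ck_on U k h -> Ck_on U k (fun x => g x + h x)%C.
Proof.
  intros HU. revert g h; induction k as [|k IH]; intros g h Hg Hh.
  - split; trivial. intros p Hp. apply continuous_Cplus; eapply Ck_continuous; eassumption.
  - apply Ck_intro with (fun v x => dderiv g v x + dderiv h v x)%C; trivial.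
    + intros p Hp. apply continuous_Cplus; eapply Ck_continuous; eassumption.
    + intros v p Hp. apply is_dderiv_plus; eapply Ck_dderiv; eassumption.
    + intros v. apply IH; now apply Ck_derivative.
Qed.

Lemma Ck_mult U k g h :
  open U -> Ck_on U k g -> Ck_on U k h -> Ck_on U k (fun x => g x * h x)%C.
Proof.
  intros HU. revert g h; induction k as [|k IH]; intros g h Hg Hh.
  - split; trivial. intros p Hp. apply continuous_Cmult; eapply Ck_continuous; eassumption.
  - apply Ck_intro with (fun v x => dderiv g v x * h x + g x * dderiv h v x)%C; trivial.
    + intros p Hp. apply continuous_Cmult; eapply Ck_continuous; eassumption.
    + intros v p Hp. apply is_dderiv_mult; eapply Ck_dderiv; eassumption.
    + intros v. apply Ck_plus; trivial; apply IH; try (now apply Ck_derivative); now apply Ck_pred.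
Qed.

Lemma Ck_conj U k g : open U -> Ck_on U k g -> Ck_on U k (fun x => Cconj (g x)).
Proof.
  intros HU. revert g; induction k as [|k IH]; intros g Hg.
  - split; trivial. intros p Hp. apply continuous_Cconj; eapply Ck_continuous; eassumption.
  - apply Ck_intro with (fun v x => Cconj (dderiv g v x)); trivial.
    + intros p Hp. apply continuous_Cconj; eapply Ck_continuous; eassumption.
    + intros v p Hp. apply is_dderiv_conj; eapply Ck_dderiv; eassumption.
    + intros v. apply IH; now apply Ck_derivative.
Qed.

Lemma Ck_inv U k g :
  open U -> (forall p, U p -> g p <> 0) -> Ck_on U k g -> Ck_on U k (fun x => / g x)%C.
Proof.
  intros HU Hn. revert g Hn; induction k as [|k IH]; intros g Hn Hg.
  - split; trivial. intros p Hp. apply continuous_Cinv; auto. eapply Ck_continuous; eassumption.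
  - apply Ck_intro with (fun v x => - (1) * dderiv g v x * (/ g x * / g x))%C; trivial.
    + intros p Hp. apply continuous_Cinv; auto; eapply Ck_continuous; eassumption.
    + intros v p Hp. replace (- (1) * dderiv g v p)%C with (- dderiv g v p)%C by ring.
      apply is_dderiv_inv; auto; eapply Ck_dderiv; eassumption.
    + intros v. apply Ck_mult; trivial. apply Ck_mult; trivial. now apply Ck_const.
      now apply Ck_derivative.
      apply Ck_mult; trivial; apply IH; trivial; now apply Ck_pred.
Qed.

(** A single derivative suffices: it is the real part of [g'/g], whose class is given by the rules
    for products, inverses and conjugates. *)
Lemma Ck_lnmod U k g :
  open U -> (forall p, U p -> g p <> 0) -> Ck_on U k g ->
  Ck_on U k (fun x => RtoC (ln (Cmod (g x)))).
Proof.
  intros HU Hn Hg.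
  assert (Hc : forall p, U p -> continuous (fun x => RtoC (ln (Cmod (g x)))) p).
  { intros p Hp. apply continuous_RtoC, continuous_lnmod; auto. eapply Ck_continuous; eassumption. }
  destruct k as [|k]. now split.
  apply Ck_intro with (fun v x => (dderiv g v x * / g x + Cconj (dderiv g v x * / g x)) * / 2)%C;
    trivial.
  - intros v p Hp. apply is_dderiv_lnmod; auto. eapply Ck_dderiv; eassumption.
  - intros v. assert (H : Ck_on U k (fun x => dderiv g v x * / g x)%C).
    { apply Ck_mult; trivial. now apply Ck_derivative. apply Ck_inv; trivial. now apply Ck_pred. }
    apply Ck_mult; trivial. apply Ck_plus; trivial. now apply Ck_conj. now apply Ck_const.
Qed.

Lemma Ck_exp U k (g : V -> R) :
  open U -> Ck_on U k (fun x => RtoC (g x)) -> Ck_on U k (fun x => RtoC (exp (g x))).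
Proof.
  intros HU. revert g; induction k as [|k IH]; intros g Hg.
  - split; trivial. intros p Hp.
    apply continuous_RtoC, continuous_exp, continuous_RtoC; eapply Ck_continuous; eassumption.
  - apply Ck_intro with (fun v x => RtoC (exp (g x)) * dderiv (fun x => RtoC (g x)) v x)%C; trivial.
    + intros p Hp.
      apply continuous_RtoC, continuous_exp, continuous_RtoC; eapply Ck_continuous; eassumption.
    + intros v p Hp. apply is_dderiv_exp. eapply Ck_dderiv; eassumption.
    + intros v. apply Ck_mult; trivial. apply IH. now apply Ck_pred.
      now apply (Ck_derivative U k _ v).
Qed.

Lemma smooth_dderiv U g v : smooth_on U g -> smooth_on U (dderiv g v).
Proof. intros H k. apply Ck_derivative, H. Qed.

Lemma smooth_d10 U g v : open U -> smooth_on U g -> smooth_on U (d10 g v).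
Proof.
  intros HU H k.
  apply Ck_ext with (fun x => (dderiv g v x + - Ci * dderiv g (scal Ci v) x) * / 2)%C; trivial.
  { intros q _. unfold d10. field. }
  apply Ck_mult; trivial; [|now apply Ck_const].
  apply Ck_plus; trivial. now apply smooth_dderiv.
  apply Ck_mult; trivial. now apply Ck_const. now apply smooth_dderiv.
Qed.

Lemma smooth_d01 U g v : open U -> smooth_on U g -> smooth_on U (d01 g v).
Proof.
  intros HU H k.
  change (Ck_on U k (fun x => (dderiv g v x + Ci * dderiv g (scal Ci v) x) * / 2)%C).
  apply Ck_mult; trivial; [|now apply Ck_const].
  apply Ck_plus; trivial. now apply smooth_dderiv.
  apply Ck_mult; trivial. now apply Ck_const. now apply smooth_dderiv.
Qed.

End DirectionalDerivatives.

(** * Functions of class C^1 on the plane *)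

Section PlaneFunctions.
Variables (U : C -> Prop) (s : C -> C).
Hypotheses (HU : open U) (Hs : Ck_on (V := C_NormedModule) U 1 s).

Let Dx := dderiv (V := C_NormedModule) s (RtoC 1).
Let Dy := dderiv (V := C_NormedModule) s Ci.

Lemma is_cderive_partial_x (x y : R) :
  U (x, y) -> is_cderive (fun u => s (u, y)) x (Dx (x, y)).
Proof.
  intros Hp. pose proof (Ck_dderiv (V := C_NormedModule) U 0 s (RtoC 1) (x, y) Hs Hp) as H.
  apply (is_derive_ext (V := C_R_NormedModule)
    (fun u => on_line (V := C_NormedModule) s (RtoC 1) (x, y) (u - x))).
  { intros u. unfold on_line. f_equal.
    apply injective_projections; unfold plus, scal; simpl; unfold mult; simpl; ring. }
  evar_last.
  apply (is_derive_comp (V := C_R_NormedModule) (on_line (V := C_NormedModule) s (RtoC 1) (x,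
    y)) (fun u => u - x) x (Dx (x, y)) 1).
  replace (x - x) with 0 by ring. exact H.
  auto_derive; trivial; ring.
  apply (scal_one (V := C_R_NormedModule)).
Qed.

Lemma is_cderive_partial_y (x y : R) :
  U (x, y) -> is_cderive (fun u => s (x, u)) y (Dy (x, y)).
Proof.
  intros Hp. pose proof (Ck_dderiv (V := C_NormedModule) U 0 s Ci (x, y) Hs Hp) as H.
  apply (is_derive_ext (V := C_R_NormedModule)
    (fun u => on_line (V := C_NormedModule) s Ci (x, y) (u - y))).
  { intros u. unfold on_line. f_equal.
    apply injective_projections; unfold plus, scal; simpl; unfold mult; simpl; ring. }
  evar_last.
  apply (is_derive_comp (V := C_R_NormedModule) (on_line (V := C_NormedModule) s Ci (x,
    y)) (fun u => u - y) y (Dy (x, y)) 1).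
  replace (y - y) with 0 by ring. exact H.
  auto_derive; trivial; ring.
  apply (scal_one (V := C_R_NormedModule)).
Qed.

(** Directional derivatives alone give no chain rule. Total differentiability comes from the
    x-partial existing near the point and being continuous at it, together with the y-partial at the
    point. This criterion concerns real functions, so [pr] stands for [Re] or [Im]. *)
Lemma is_derive_component (pr : C -> R) (z : R -> C) t l :
  (forall g u m, is_cderive g u m -> is_derive (fun x => pr (g x)) u (pr m)) ->
  (forall (g : C -> C) x, continuous g x -> continuous (fun x => pr (g x)) x) ->
  is_cderive z t l -> U (z t) ->
  is_derive (fun x => pr (s (z x))) t (Re l * pr (Dx (z t)) + Im l * pr (Dy (z t))).
Proof.
  intros Hpr Hprc Hz Hp.
  destruct (z t) as [x y] eqn:E.
  assert (D : filterdiff (fun u : R * R => pr (s (fst u, snd u))) (locally (x, y))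
     (fun u : R * R => plus (scal (fst u) (pr (Dx (x, y))))
       (scal (snd u) (pr (Dy (x, y)))))).
  { apply (is_derive_filterdiff (fun x y => pr (s (x, y))) x y (fun x y => pr (Dx (x, y)))).
    - eapply filter_imp; [|exact (HU (x, y) Hp)].
      intros [u v] Huv; simpl.
      apply (Hpr (fun z => s (z, v))), is_cderive_partial_x, Huv.
    - apply (Hpr (fun z => s (x, z))), is_cderive_partial_y, Hp.
    - apply (continuous_ext (fun u : R * R => pr (Dx u))).
      now intros [u v].
      apply (Hprc Dx).
      exact (Ck_continuous (V := C_NormedModule) _ 0 _ _ (Ck_derivative (V := C_NormedModule)
        _ 0 _ (RtoC 1) Hs) Hp). }
  rewrite <- E in D.
  pose proof (filterdiff_comp' (V := C_R_NormedModule) z _ t _ _ Hz D) as H.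
  eapply (filterdiff_ext_lin _ _).
  - eapply (filterdiff_ext (V := R_NormedModule)); [|exact H].
    intros u; simpl. now destruct (z u).
  - intros u. simpl. rewrite E. unfold scal; simpl; unfold prod_scal, plus, scal; simpl;
      unfold mult; simpl.
    unfold Re, Im. ring.
Qed.

Lemma is_cderive_comp (z : R -> C) t l :
  is_cderive z t l -> U (z t) ->
  is_cderive (fun x => s (z x)) t (RtoC (Re l) * Dx (z t) + RtoC (Im l) * Dy (z t))%C.
Proof.
  intros Hz Hp. apply is_cderive_iff. split.
  - evar_last. apply (is_derive_component Re); try eassumption.
    now intros g u m [H _]%is_cderive_iff. now intros g u [H _]%continuous_C_iff.
    unfold Re, Im; simpl; ring.
  - evar_last. apply (is_derive_component Im); try eassumption.
    now intros g u m [_ H]%is_cderive_iff. now intros g u [_ H]%continuous_C_iff.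
    unfold Re, Im; simpl; ring.
Qed.

Let line_cderive (v p : C) :
  is_cderive (fun t => plus (p : C_NormedModule) (scal (RtoC t) (v : C_NormedModule))) 0 v.
Proof.
  apply is_cderive_iff; split;
  (eapply is_derive_ext; [intros t; unfold plus, scal; simpl; unfold mult; simpl; reflexivity|]);
  auto_derive; trivial; unfold Re, Im; simpl; ring.
Qed.

(** Linearity in the direction is the chain rule applied to the line through [p] with velocity
    [v]. *)
Lemma dderiv_real_linear (v p : C) :
  U p ->
  dderiv (V := C_NormedModule) s v p = (RtoC (Re v) * Dx p + RtoC (Im v) * Dy p)%C.
Proof.
  intros Hp. apply dderiv_unique. pose proof (line_cderive v p) as H.
  assert (E : plus (p : C_NormedModule) (scal (RtoC 0) (v : C_NormedModule)) = p).
  { exact (on_line_0 (V := C_NormedModule) (fun x => x) v p). }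
  pose proof (is_cderive_comp _ _ _ H) as H1. cbv beta in H1. rewrite E in H1. now apply H1.
Qed.

Lemma dderiv_d10_d01 (v p : C) :
  U p -> dderiv (V := C_NormedModule) s v p =
   (v * d10 (V := C_NormedModule) s (RtoC 1) p + Cconj v * d01 (V := C_NormedModule) s (RtoC 1)
     p)%C.
Proof.
  intros Hp. unfold d01, d10. rewrite !(dderiv_real_linear _ p Hp).
  unfold scal; simpl; unfold mult; simpl. destruct v as [a b].
  apply injective_projections; simpl; field.
Qed.

Lemma is_cderive_comp_d (z : R -> C) t l :
  is_cderive z t l -> U (z t) ->
  is_cderive (fun x => s (z x)) t
    (l * d10 (V := C_NormedModule) s (RtoC 1) (z t) + Cconj l * d01 (V := C_NormedModule)
      s (RtoC 1) (z t))%C.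
Proof.
  intros Hz Hp. rewrite <- (dderiv_d10_d01 l (z t) Hp), (dderiv_real_linear l _ Hp).
  now apply is_cderive_comp.
Qed.
End PlaneFunctions.

(** * Wirtinger derivatives *)

(* The derivatives of [g] along [v] and [i v] exist and amount to [d10 g v p = a] and
   [d01 g v p = b]. *)
Definition is_wirtinger {V : NormedModule C_AbsRing} (g : V -> C) (v p : V) (a b : C) : Prop :=
  is_dderiv g v p (a + b)%C /\ is_dderiv g (scal Ci v) p (Ci * (a - b))%C.

Lemma is_dderiv_eq {V : NormedModule C_AbsRing} (g : V -> C) v p (l l' : C) :
  is_dderiv g v p l -> l = l' -> is_dderiv g v p l'.
Proof. now intros H <-. Qed.

Section Wirtinger.
Context {V : NormedModule C_AbsRing}.
Implicit Types (g h : V -> C) (p v : V) (a b : C).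

Lemma is_wirtinger_d10 g v p a b : is_wirtinger g v p a b -> d10 g v p = a.
Proof.
  intros [H1 H2]. unfold d10.
  rewrite (dderiv_unique _ _ _ _ H1), (dderiv_unique _ _ _ _ H2).
  rewrite Cmult_assoc, Ci_sqr. field.
Qed.

Lemma is_wirtinger_d01 g v p a b : is_wirtinger g v p a b -> d01 g v p = b.
Proof.
  intros [H1 H2]. unfold d01.
  rewrite (dderiv_unique _ _ _ _ H1), (dderiv_unique _ _ _ _ H2).
  rewrite Cmult_assoc, Ci_sqr. field.
Qed.

Lemma is_wirtinger_eq g v p a b a' b' :
  is_wirtinger g v p a b -> a = a' -> b = b' -> is_wirtinger g v p a' b'.
Proof. now intros H <- <-. Qed.

Lemma is_wirtinger_ext U g h v p a b :
  open U -> U p -> (forall q, U q -> g q = h q) ->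
  is_wirtinger g v p a b -> is_wirtinger h v p a b.
Proof.
  intros HU Hp E [H1 H2]; split; eapply (is_dderiv_ext U g h); eassumption.
Qed.

Lemma is_wirtinger_const (k : C) v p : is_wirtinger (fun _ => k) v p 0 0.
Proof.
  split; [replace (0 + 0)%C with (RtoC 0) by ring | replace (Ci * (0 - 0))%C with (RtoC 0) by ring];
  apply is_dderiv_const.
Qed.

Lemma is_wirtinger_plus g h v p a b a' b' :
  is_wirtinger g v p a b -> is_wirtinger h v p a' b' ->
  is_wirtinger (fun x => g x + h x)%C v p (a + a')%C (b + b')%C.
Proof.
  intros [H1 H2] [H3 H4]; split.
  - replace (a + a' + (b + b'))%C with ((a + b) + (a' + b'))%C by ring.
    now apply is_dderiv_plus.
  - replace (Ci * (a + a' - (b + b')))%C with (Ci * (a - b) + Ci * (a' - b'))%C by ring.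
    now apply is_dderiv_plus.
Qed.

Lemma is_wirtinger_mult g h v p a b a' b' :
  is_wirtinger g v p a b -> is_wirtinger h v p a' b' ->
  is_wirtinger (fun x => g x * h x)%C v p (a * h p + g p * a')%C (b * h p + g p * b')%C.
Proof.
  intros [H1 H2] [H3 H4]; split.
  - replace (a * h p + g p * a' + (b * h p + g p * b'))%C
      with ((a + b) * h p + g p * (a' + b'))%C by ring.
    now apply is_dderiv_mult.
  - replace (Ci * (a * h p + g p * a' - (b * h p + g p * b')))%C
      with (Ci * (a - b) * h p + g p * (Ci * (a' - b')))%C by ring.
    now apply is_dderiv_mult.
Qed.

Lemma is_wirtinger_scal (k : C) g v p a b :
  is_wirtinger g v p a b -> is_wirtinger (fun x => k * g x)%C v p (k * a)%C (k * b)%C.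
Proof.
  intros H. eapply is_wirtinger_eq.
  apply is_wirtinger_mult. apply is_wirtinger_const. exact H. simpl; ring. simpl; ring.
Qed.

Lemma is_wirtinger_minus g h v p a b a' b' :
  is_wirtinger g v p a b -> is_wirtinger h v p a' b' ->
  is_wirtinger (fun x => g x - h x)%C v p (a - a')%C (b - b')%C.
Proof.
  intros H1 H2. pose proof (is_wirtinger_plus _ _ _ _ _ _ _ _ H1 (is_wirtinger_scal (- (1))
    _ _ _ _ _ H2)) as H.
  replace (a - a')%C with (a + - (1) * a')%C by ring.
  replace (b - b')%C with (b + - (1) * b')%C by ring.
  destruct H as [H H']. split; (eapply (is_dderiv_ext (fun _ => True)); [apply open_true| easy | |
    eassumption]);
  intros q _; simpl; ring.
Qed.

Lemma is_wirtinger_conj g v p a b :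
  is_wirtinger g v p a b -> is_wirtinger (fun x => Cconj (g x)) v p (Cconj b) (Cconj a).
Proof.
  intros [H1 H2]; split.
  - replace (Cconj b + Cconj a)%C with (Cconj (a + b)) by (rewrite Cplus_conj; ring).
    now apply is_dderiv_conj.
  - replace (Ci * (Cconj b - Cconj a))%C with (Cconj (Ci * (a - b))).
    now apply is_dderiv_conj.
    apply injective_projections; simpl; ring.
Qed.

Lemma is_wirtinger_inv g v p a b :
  is_wirtinger g v p a b -> g p <> 0 ->
  is_wirtinger (fun x => / g x)%C v p (- a * (/ g p * / g p))%C (- b * (/ g p * / g p))%C.
Proof.
  intros [H1 H2] Hn; split.
  - match goal with |- is_dderiv _ _ _ ?l =>
      replace l with (- (a + b) * (/ g p * / g p))%C by ring end.
    now apply is_dderiv_inv.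
  - match goal with |- is_dderiv _ _ _ ?l =>
      replace l with (- (Ci * (a - b)) * (/ g p * / g p))%C by ring end.
    now apply is_dderiv_inv.
Qed.

Lemma is_wirtinger_lnmod g v p a b :
  is_wirtinger g v p a b -> g p <> 0 ->
  is_wirtinger (fun x => RtoC (ln (Cmod (g x)))) v p
    ((a * / g p + Cconj b * / Cconj (g p)) * / 2)%C
    ((b * / g p + Cconj a * / Cconj (g p)) * / 2)%C.
Proof.
  intros [H1 H2] Hn. pose proof (is_dderiv_lnmod _ _ _ _ H1 Hn) as H3.
  pose proof (is_dderiv_lnmod _ _ _ _ H2 Hn) as H4.
  rewrite Cmult_conj, Cinv_conj in H3, H4 by exact Hn.
  rewrite Cplus_conj in H3. rewrite Cmult_conj, Cminus_conj in H4.
  rewrite Cconj_Ci in H4.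
  split; (eapply is_dderiv_eq; [eassumption|]); ring.
Qed.

Lemma is_wirtinger_exp (g : V -> R) v p a b :
  is_wirtinger (fun x => RtoC (g x)) v p a b ->
  is_wirtinger (fun x => RtoC (exp (g x))) v p (RtoC (exp (g p)) * a)%C (RtoC (exp (g p)) * b)%C.
Proof.
  intros [H1 H2].
  split; (eapply is_dderiv_eq; [apply is_dderiv_exp; eassumption|]); ring.
Qed.
End Wirtinger.

(** * Calculus on [C^*] and on the covering space *)

Notation dz10 g := (d10 (V := C_NormedModule) g (RtoC 1)).
Notation dz01 g := (d01 (V := C_NormedModule) g (RtoC 1)).

(* [ring] and [field] recognise only the carrier [C], not its unfolding as the carrier of
   a normed module. *)
Ltac beta_C := cbv beta; change (NormedModule.sort C_AbsRing C_NormedModule) with C.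

Notation V2 := (prod_NormedModule C_AbsRing C_NormedModule C_NormedModule).

Lemma open_Cstar : open (T := C_NormedModule) Cstar.
Proof.
  intros z Hz. unfold Cstar in *.
  assert (H : 0 < Cmod z) by now apply Cmod_gt_0.
  assert (Hc : continuous (fun x : C_NormedModule => Cmod x) z).
  { apply continuous_Cmod. apply continuous_id. }
  specialize (Hc (fun r => 0 < r)).
  unfold filtermap in Hc.
  eapply filter_imp; [|apply Hc; exact (open_gt 0 _ H)].
  intros x Hx E. simpl in Hx. rewrite E, Cmod_0 in Hx. lra.
Qed.

Lemma open_cover : open (T := V2) cover.
Proof.
  apply (open_comp fst Cstar). intros [z w] _. apply continuous_fst. apply open_Cstar.
Qed.

(** By mere computation, the derivative of [g o fst] along [v] is the derivative of [g] along
    [fst v], composed with [fst]; the induction hypothesis therefore applies as it stands. *)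
Lemma Ck_comp_fst k (g : C -> C) :
  Ck_on (V := C_NormedModule) Cstar k g -> Ck_on (V := V2) cover k (fun p : C * C => g (fst p)).
Proof.
  revert g; induction k as [|k IH]; intros g [Hc H].
  - split; trivial. intros [z w] Hp. apply (continuous_comp fst g). apply continuous_fst.
    now apply Hc.
  - split. intros [z w] Hp. apply (continuous_comp fst g). apply continuous_fst. now apply Hc.
    intros v. destruct (H (fst v)) as [H1 H2]. split.
    + intros p Hp. exact (H1 (fst p) Hp).
    + exact (IH _ H2).
Qed.

Lemma is_dderiv_fst (v p : C * C) : is_dderiv (V := V2) (fun x : C * C => fst x) v p (fst v).
Proof.
  destruct v as [[a b] w], p as [[x y] w'].
  apply is_cderive_iff; split;
  (eapply is_derive_ext; [intros t; unfold on_line, plus, scal; simpl; unfold plus, scal; simpl;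
    unfold mult; simpl; reflexivity|]);
  auto_derive; trivial; unfold Re, Im; simpl; ring.
Qed.

Lemma is_dderiv_snd (v p : C * C) : is_dderiv (V := V2) (fun x : C * C => snd x) v p (snd v).
Proof.
  destruct v as [w [a b]], p as [w' [x y]].
  apply is_cderive_iff; split;
  (eapply is_derive_ext; [intros t; unfold on_line, plus, scal; simpl; unfold plus, scal; simpl;
    unfold mult; simpl; reflexivity|]);
  auto_derive; trivial; unfold Re, Im; simpl; ring.
Qed.

Lemma is_wirtinger_fst (v p : C * C) : is_wirtinger (V := V2) (fun x : C * C => fst x) v p (fst v)
  0.
Proof.
  split; (eapply is_dderiv_eq; [apply is_dderiv_fst|]). ring.
  destruct v as [a b]; simpl; unfold scal; simpl; unfold mult; simpl; ring.
Qed.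

Lemma is_wirtinger_snd (v p : C * C) : is_wirtinger (V := V2) (fun x : C * C => snd x) v p (snd v)
  0.
Proof.
  split; (eapply is_dderiv_eq; [apply is_dderiv_snd|]). ring.
  destruct v as [a b]; simpl; unfold scal; simpl; unfold mult; simpl; ring.
Qed.

(** Replacing the direction [v] by [i v] multiplies the part in [v] by [i] and the part in [conj v]
    by [-i], which is the sign pattern of [is_wirtinger]. *)
Lemma plane_wirtinger (g : C -> C) (v z : C) :
  Ck_on (V := C_NormedModule) Cstar 1 g -> Cstar z ->
  is_wirtinger (V := C_NormedModule) g v z (v * dz10 g z)%C (Cconj v * dz01 g z)%C.
Proof.
  intros Hg Hz.
  assert (H : forall u : C, is_dderiv (V := C_NormedModule)
    g u z (u * dz10 g z + Cconj u * dz01 g z)%C).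
  { intros u. rewrite <- (dderiv_d10_d01 Cstar g open_Cstar Hg) by exact Hz.
    exact (Ck_dderiv (V := C_NormedModule) Cstar 0 g u z Hg Hz). }
  split. apply H. eapply is_dderiv_eq; [apply H|].
  unfold scal; simpl; unfold mult; simpl.
  rewrite Cmult_conj. rewrite Cconj_Ci.
  ring.
Qed.

Lemma is_wirtinger_comp_fst (g : C -> C) (v p : C * C) :
  Ck_on (V := C_NormedModule) Cstar 1 g -> cover p ->
  is_wirtinger (V := V2) (fun x : C * C => g (fst x)) v p
    (fst v * dz10 g (fst p))%C (Cconj (fst v) * dz01 g (fst p))%C.
Proof. intros Hg Hp. destruct (plane_wirtinger g (fst v) (fst p) Hg Hp). now split. Qed.

Lemma is_wirtinger_id (v z : C) : is_wirtinger (V := C_NormedModule) (fun x : C => x) v z v 0.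
Proof.
  assert (H : forall u : C, is_dderiv (V := C_NormedModule) (fun x : C => x) u z u).
  { intros u. apply is_cderive_iff; split;
    (eapply is_derive_ext; [intros t; unfold on_line, plus, scal; simpl; unfold mult; simpl;
      reflexivity|]);
    auto_derive; trivial; unfold Re, Im; simpl; ring. }
  split; (eapply is_dderiv_eq; [apply H|]). ring.
  unfold scal; simpl; unfold mult; simpl; ring.
Qed.

Lemma Ck_fst k : Ck_on (V := V2) cover k (fun p : C * C => fst p).
Proof.
  destruct k as [|k].
  - split; trivial. intros [z w] _. apply continuous_fst.
  - apply Ck_intro with (fun v _ => fst v). apply open_cover.
    intros [z w] _. apply continuous_fst. intros; apply is_dderiv_fst.
    intros; apply (Ck_const (V := V2)), open_cover.
Qed.

Lemma Ck_snd k : Ck_on (V := V2) cover k (fun p : C * C => snd p).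
Proof.
  destruct k as [|k].
  - split; trivial. intros [z w] _. apply continuous_snd.
  - apply Ck_intro with (fun v _ => snd v). apply open_cover.
    intros [z w] _. apply continuous_snd. intros; apply is_dderiv_snd.
    intros; apply (Ck_const (V := V2)), open_cover.
Qed.

Lemma Ck_id k : Ck_on (V := C_NormedModule) Cstar k (fun z => z).
Proof.
  destruct k as [|k].
  - split; trivial. intros z _. apply continuous_id.
  - apply Ck_intro with (fun v _ => v). apply open_Cstar.
    intros z _. apply continuous_id.
    intros v p _.
    apply is_cderive_iff; split;
    (eapply is_derive_ext; [intros t; unfold on_line, plus, scal; simpl; unfold mult; simpl;
      reflexivity|]);
    auto_derive; trivial; unfold Re, Im; simpl; ring.
    intros; apply (Ck_const (V := C_NormedModule)), open_Cstar.
Qed.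

(** * The weight and the form [eta] *)

(** The slope is expressed through [n / (2 log|alpha|)], the constant of [gauduchon_f], so that
    [q'], [q''] and [f] share the single constant [k2]. *)
Lemma Derive_qfun (n : nat) (alpha : C) (x : R) :
  Derive (qfun n alpha) x = INR n - 4 * (INR n / (2 * ln (Cmod alpha))) * x.
Proof.
  (* [Rinv_mult] holds for the total inverse, so [/ ln |alpha|] can be turned into an opaque number
     and the claim is polynomial in it. *)
  apply is_derive_unique. unfold qfun, Rdiv. rewrite Rinv_mult.
  generalize (/ ln (Cmod alpha)) as i. intros i. auto_derive; trivial.
  field.
Qed.

Lemma wtilde_wirtinger (s : C -> C) (v p : C * C) :
  Ck_on (V := C_NormedModule) Cstar 1 s -> cover p ->
  is_wirtinger (V := V2) (wtilde s) v p
    (snd v + fst v * d10 (V := C_NormedModule) s (RtoC 1) (fst p))%C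
    (Cconj (fst v) * d01 (V := C_NormedModule) s (RtoC 1) (fst p))%C.
Proof.
  intros Hs Hp. eapply is_wirtinger_eq.
  apply (is_wirtinger_plus (V := V2) (fun x : C * C => snd x) (fun x : C * C => s (fst x))).
  apply is_wirtinger_snd. now apply is_wirtinger_comp_fst.
  reflexivity. ring.
Qed.

Section Weight.
Variables (n : nat) (alpha : C).

Let k2 := RtoC (INR n / (2 * ln (Cmod alpha))).
Let Q (z : C) := RtoC (Derive (qfun n alpha) (ln (Cmod z))).

Lemma lnmod_wirtinger (v p : C * C) :
  cover p ->
  is_wirtinger (V := V2) (fun x : C * C => RtoC (ln (Cmod (fst x)))) v p
    (fst v * / fst p * / 2)%C (Cconj (fst v) * Cconj (/ fst p) * / 2)%C.
Proof.
  intros Hp. eapply is_wirtinger_eq.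
  apply (is_wirtinger_lnmod (V := V2) (fun x : C * C => fst x)). apply is_wirtinger_fst. exact Hp.
  rewrite Cconj_RtoC. ring.
  rewrite Cinv_conj by exact Hp. ring.
Qed.

Lemma qprime_eq (z : C) : Q z = (RtoC (INR n) - 4 * k2 * RtoC (ln (Cmod z)))%C.
Proof.
  unfold Q, k2. now rewrite Derive_qfun, RtoC_minus, !RtoC_mult.
Qed.

Lemma qprime_wirtinger (v p : C * C) :
  cover p ->
  is_wirtinger (V := V2) (fun x : C * C => Q (fst x)) v p
    (- (2 * k2 * (fst v * / fst p)))%C (- (2 * k2 * (Cconj (fst v) * Cconj (/ fst p))))%C.
Proof.
  intros Hp.
  apply (is_wirtinger_ext (V := V2) (fun _ => True)
    (fun x : C * C => RtoC (INR n) - 4 * k2 * RtoC (ln (Cmod (fst x))))%C); [apply open_true|easy|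
      |].
  { intros q _. now rewrite qprime_eq. }
  eapply is_wirtinger_eq.
  apply is_wirtinger_minus. apply is_wirtinger_const.
  apply is_wirtinger_scal. apply lnmod_wirtinger, Hp.
  field. exact Hp.
  rewrite Cinv_conj by exact Hp. field.
  now apply Cconj_neq_0.
Qed.

Lemma Lambda_wirtinger (v p : C * C) :
  cover p ->
  is_wirtinger (V := V2) (fun x : C * C => RtoC (Lambda n alpha x)) v p
    (RtoC (Lambda n alpha p) * (Q (fst p) * (fst v * / fst p * / 2)))%C
    (RtoC (Lambda n alpha p) * (Q (fst p) * (Cconj (fst v) * Cconj (/ fst p) * / 2)))%C.
Proof.
  intros Hp. apply is_wirtinger_exp.
  set (l := fun x : C * C => RtoC (ln (Cmod (fst x)))).
  apply (is_wirtinger_ext (V := V2) (fun _ => True)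
    (fun x : C * C => RtoC (INR n) * l x - 2 * k2 * (l x * l x))%C); [apply open_true|easy| |].
  { intros q _. unfold qfun, l, k2. rewrite <- !RtoC_mult, <- RtoC_minus. f_equal.
    unfold Rdiv. rewrite Rinv_mult. generalize (/ ln (Cmod alpha)) as i. intros i. field. }
  pose proof (lnmod_wirtinger v p Hp) as H. fold l in H.
  rewrite qprime_eq. fold (l p).
  eapply is_wirtinger_eq.
  apply is_wirtinger_minus. apply is_wirtinger_scal, H.
  apply is_wirtinger_scal, is_wirtinger_mult; exact H.
  fold (l p). ring. fold (l p). ring.
Qed.

Lemma Ck_lnmod_C k : Ck_on (V := C_NormedModule) Cstar k (fun z => RtoC (ln (Cmod z))).
Proof.
  apply (Ck_lnmod (V := C_NormedModule)). apply open_Cstar. easy. apply Ck_id.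
Qed.

Lemma Ck_Q k : Ck_on (V := C_NormedModule) Cstar k Q.
Proof.
  apply Ck_ext with (fun z => RtoC (INR n) + (- (4 * k2)) * RtoC (ln (Cmod z)))%C.
  apply open_Cstar. intros z _. rewrite qprime_eq. change C in z. ring.
  apply Ck_plus. apply open_Cstar. apply Ck_const, open_Cstar.
  apply Ck_mult. apply open_Cstar. apply Ck_const, open_Cstar. apply Ck_lnmod_C.
Qed.

(** [Lambda] viewed on the base [C^*], where it can be bounded over an annulus. *)
Definition weight (z : C) : R := exp (qfun n alpha (ln (Cmod z))).

Lemma Ck_weight k : Ck_on (V := C_NormedModule) Cstar k (fun z => RtoC (weight z)).
Proof.
  apply (Ck_exp (V := C_NormedModule)). apply open_Cstar.
  apply Ck_ext with (fun z => RtoC (INR n) * RtoC (ln (Cmod z)) + - (2 * k2) * (RtoC (ln (Cmod z))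
    * RtoC (ln (Cmod z))))%C.
  apply open_Cstar.
  { intros q _. unfold qfun, k2. rewrite <- !RtoC_mult, <- RtoC_opp, <- RtoC_mult, <- RtoC_plus.
    f_equal.
    unfold Rdiv. rewrite Rinv_mult. generalize (/ ln (Cmod alpha)) as i. intros i. field. }
  pose proof (Ck_lnmod_C k).
  repeat first [apply open_Cstar | apply Ck_plus | apply Ck_mult | exact H | apply Ck_const].
Qed.

End Weight.

(** * The Gauduchon equation *)

Definition hcoef (n : nat) (alpha : C) (s : C -> C) (p : C * C) : C :=
  (dz10 s (fst p)
      + RtoC (Derive (qfun n alpha) (ln (Cmod (fst p)))) / (2 * fst p) * wtilde s p)%C.

(* [dw_bar /\ dz /\ dz_bar]. *)
Definition det3 (u v w : C * C) : C :=
  (Cconj (snd u) * (fst v * Cconj (fst w) - fst w * Cconj (fst v))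
   - Cconj (snd v) * (fst u * Cconj (fst w) - fst w * Cconj (fst u))
   + Cconj (snd w) * (fst u * Cconj (fst v) - fst v * Cconj (fst u)))%C.

(** Leibniz rule for [omega] on constant vectors, with [f], [Lambda], [1/z] and the [dz]-coefficient
    of [eta] replaced by arbitrary functions so that [ring] meets only opaque values. The 0 for [zi]
    records that [1/z] is holomorphic. *)
Lemma omega_wirtinger (F L zi h : C * C -> C) (c : C) (v p u w : C * C) F1 F2 L1 L2 z1 h1 h2 :
  is_wirtinger (V := V2) F v p F1 F2 ->
  is_wirtinger (V := V2) L v p L1 L2 ->
  is_wirtinger (V := V2) zi v p z1 0 ->
  is_wirtinger (V := V2) h v p h1 h2 ->
  is_wirtinger (V := V2) (fun x : C * C =>
    Ci * F x * (fst u * zi x * Cconj (fst w * zi x) - fst w * zi x * Cconj (fst u * zi x)) +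
    Ci * c * L x * ((snd u + h x * fst u) * Cconj (snd w + h x * fst w)
                  - (snd w + h x * fst w) * Cconj (snd u + h x * fst u)))%C v p
   (Ci * (F1 * zi p * Cconj (zi p) + F p * z1 * Cconj (zi p))
       * (fst u * Cconj (fst w) - fst w * Cconj (fst u)) +
    Ci * c * L1 * ((snd u + h p * fst u) * Cconj (snd w + h p * fst w)
                  - (snd w + h p * fst w) * Cconj (snd u + h p * fst u)) +
    Ci * c * L p *
      (h1 * fst u * Cconj (snd w + h p * fst w) - h1 * fst w * Cconj (snd u + h p * fst u)
      + (snd u + h p * fst u) * (Cconj h2 * Cconj (fst w))
      - (snd w + h p * fst w) * (Cconj h2 * Cconj (fst u))))%C
   (Ci * (F2 * zi p * Cconj (zi p) + F p * zi p * Cconj z1)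
       * (fst u * Cconj (fst w) - fst w * Cconj (fst u)) +
    Ci * c * L2 * ((snd u + h p * fst u) * Cconj (snd w + h p * fst w)
                  - (snd w + h p * fst w) * Cconj (snd u + h p * fst u)) +
    Ci * c * L p *
      (h2 * fst u * Cconj (snd w + h p * fst w) - h2 * fst w * Cconj (snd u + h p * fst u)
      + (snd u + h p * fst u) * (Cconj h1 * Cconj (fst w))
      - (snd w + h p * fst w) * (Cconj h1 * Cconj (fst u))))%C.
Proof.
  intros HF HL Hz Hh.
  assert (Hzeta : forall a : C, is_wirtinger (V := V2)
    (fun x : C * C => a * zi x)%C v p (a * z1)%C 0).
  { intros a. eapply is_wirtinger_eq. apply is_wirtinger_scal, Hz. ring. ring. }
  assert (Heta : forall a b : C, is_wirtinger (V := V2)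
    (fun x : C * C => a + h x * b)%C v p (h1 * b)%C (h2 * b)%C).
  { intros a b. eapply is_wirtinger_eq. apply is_wirtinger_plus. apply is_wirtinger_const.
    apply is_wirtinger_mult. exact Hh. apply is_wirtinger_const. cbv beta; ring. cbv beta; ring. }
  eapply is_wirtinger_eq.
  apply is_wirtinger_plus.
  - apply is_wirtinger_mult. apply is_wirtinger_scal, HF.
    apply is_wirtinger_minus; (apply is_wirtinger_mult; [apply Hzeta | apply is_wirtinger_conj,
      Hzeta]).
  - apply is_wirtinger_mult. apply is_wirtinger_mult. apply is_wirtinger_const. exact HL.
    apply is_wirtinger_minus; (apply is_wirtinger_mult; [apply Heta | apply is_wirtinger_conj,
      Heta]).
  - cbv beta. repeat rewrite ?Cmult_conj, ?Cplus_conj, ?Cconj_RtoC. ring.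
  - cbv beta. repeat rewrite ?Cmult_conj, ?Cplus_conj, ?Cconj_RtoC. ring.
Qed.

Section Gauduchon.
Variables (n : nat) (alpha : C) (s : C -> C).
Hypothesis Hs : smooth_on (V := C_NormedModule) Cstar s.

Let k2 := RtoC (INR n / (2 * ln (Cmod alpha))).
Let Q (z : C) := RtoC (Derive (qfun n alpha) (ln (Cmod z))).
Let T (z : C) := dz01 (dz10 s) z.

Lemma smooth_dz10 : smooth_on (V := C_NormedModule) Cstar (dz10 s).
Proof. apply smooth_d10. apply open_Cstar. exact Hs. Qed.

Lemma smooth_dz01 : smooth_on (V := C_NormedModule) Cstar (dz01 s).
Proof. apply smooth_d01. apply open_Cstar. exact Hs. Qed.

(** The [k2] terms come from [q'' = - 4 k2]. The one in the (0,1) part carries [wtilde], hence [w],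
    and is the term that [f] has to cancel. *)
Lemma hcoef_wirtinger (v p : C * C) :
  cover p ->
  is_wirtinger (V := V2) (hcoef n alpha s) v p
   (fst v * dz10 (dz10 s) (fst p)
    - k2 * (fst v * / fst p * / fst p) * wtilde s p
    - Q (fst p) * (/ fst p * / fst p * / 2) * fst v * wtilde s p
    + Q (fst p) * (/ fst p * / 2) * (snd v + fst v * dz10 s (fst p)))%C
   (Cconj (fst v) * (T (fst p) - k2 * (Cconj (/ fst p) * / fst p) * wtilde s p
     + Q (fst p) * (/ fst p * / 2) * dz01 s (fst p)))%C.
Proof.
  intros Hp.
  assert (Hp' := Cconj_neq_0 _ Hp).
  apply (is_wirtinger_ext (V := V2) cover
    (fun x : C * C => dz10 s (fst x) + Q (fst x) * (/ 2 * / fst x) * wtilde s x)%C).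
  apply open_cover. exact Hp.
  { intros q Hq. unfold hcoef, Q. field. exact Hq. }
  eapply is_wirtinger_eq.
  apply is_wirtinger_plus. apply is_wirtinger_comp_fst. apply smooth_dz10. exact Hp.
  apply is_wirtinger_mult.
  apply is_wirtinger_mult. apply qprime_wirtinger, Hp.
  apply is_wirtinger_scal, (is_wirtinger_inv (V := V2) (fun x : C * C => fst x)).
  apply is_wirtinger_fst. exact Hp.
  apply wtilde_wirtinger. apply Hs. exact Hp.
  - beta_C. fold k2 Q. field. exact Hp.
  - beta_C. fold k2 Q. fold (T (fst p)). rewrite !Cinv_conj by exact Hp. field. split; assumption.
Qed.

(** The (1,0) derivative stays anonymous: [f] is differentiated only by [delbar], and has
    disappeared from the result before [del] is applied. *)
Lemma gauduchon_f_wirtinger (a c : R) (v p : C * C) :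
  cover p ->
  exists A, is_wirtinger (V := V2) (fun x => RtoC (gauduchon_f n alpha s a c x)) v p A
   (- k2 * RtoC c * RtoC (Lambda n alpha p) *
     (Q (fst p) * (Cconj (fst v) * Cconj (/ fst p) * / 2) * (wtilde s p * Cconj (wtilde s p))
      + Cconj (fst v) * dz01 s (fst p) * Cconj (wtilde s p)
      + wtilde s p * Cconj (snd v + fst v * dz10 s (fst p))))%C.
Proof.
  intros Hp. eexists.
  apply (is_wirtinger_ext (V := V2) (fun _ => True)
    (fun x : C * C => RtoC a + - k2 * RtoC c * (RtoC (Lambda n alpha x)
      * (wtilde s x * Cconj (wtilde s x))))%C); [apply open_true|easy| |].
  { intros q _. unfold gauduchon_f, k2. rewrite <- Cmod2_conj, <- RtoC_opp, <- !RtoC_mult,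
      <- RtoC_plus. f_equal. ring. }
  assert (Hw := wtilde_wirtinger s v p (Hs 1%nat) Hp).
  eapply is_wirtinger_eq.
  apply is_wirtinger_plus. apply is_wirtinger_const.
  apply is_wirtinger_scal, is_wirtinger_mult. apply Lambda_wirtinger, Hp.
  apply is_wirtinger_mult. exact Hw. apply is_wirtinger_conj, Hw.
  reflexivity.
  beta_C. fold (Q (fst p)). ring.
Qed.

(* With [h = Q w~ / (2 z) + ds/dz] one has [eta = dw + h dz], and the terms of
   [delbar omega] coming from [f] and from [Lambda] cancel against those of [dh] that
   involve [w]; what remains is a multiple of [dw_bar /\ dz /\ dz_bar] by a function of
   [z] alone, and is therefore killed by [del]. *)
Definition delbar_coef (c : R) (z : C) : C :=
  (- Ci * RtoC c * RtoC (weight n alpha z) * (T z + Q z * (/ z * / 2) * dz01 s z))%C.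

Lemma delbar_omega (a c : R) (p u0 u1 u2 : C * C) :
  cover p ->
  delbar (omega n alpha s (gauduchon_f n alpha s a c) c) p u0 u1 u2 =
  (delbar_coef c (fst p) * det3 u0 u1 u2)%C.
Proof.
  intros Hp.
  set (f := RtoC (gauduchon_f n alpha s a c p)).
  set (h := hcoef n alpha s p). set (L := RtoC (Lambda n alpha p)). set (zi := (/ fst p)%C).
  set (f2 := fun v : C * C => (- k2 * RtoC c * L *
     (Q (fst p) * (Cconj (fst v) * Cconj (zi) * / 2) * (wtilde s p * Cconj (wtilde s p))
      + Cconj (fst v) * dz01 s (fst p) * Cconj (wtilde s p)
      + wtilde s p * Cconj (snd v + fst v * dz10 s (fst p))))%C).
  set (l2 := fun v : C * C =>
    (L * (Q (fst p) * (Cconj (fst v) * Cconj (zi) * / 2)))%C).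
  set (z1 := fun v : C * C => (- fst v * (zi * zi))%C).
  set (h1 := fun v : C * C => (fst v * dz10 (dz10 s) (fst p)
    - k2 * (fst v * zi * zi) * wtilde s p
    - Q (fst p) * (zi * zi * / 2) * fst v * wtilde s p
    + Q (fst p) * (zi * / 2) * (snd v + fst v * dz10 s (fst p)))%C).
  set (h2 := fun v : C * C => (Cconj (fst v) * (T (fst p) - k2 * (Cconj (zi) * zi) * wtilde s p
     + Q (fst p) * (zi * / 2) * dz01 s (fst p)))%C).
  assert (H : forall v u w : C * C,
    d01 (V := V2) (fun x => omega n alpha s (gauduchon_f n alpha s a c) c x u w) v p =
   (Ci * (f2 v * zi * Cconj zi + f * zi * Cconj (z1 v))
       * (fst u * Cconj (fst w) - fst w * Cconj (fst u)) +
    Ci * RtoC c * l2 v * ((snd u + h * fst u) * Cconj (snd w + h * fst w)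
                  - (snd w + h * fst w) * Cconj (snd u + h * fst u)) +
    Ci * RtoC c * L *
      (h2 v * fst u * Cconj (snd w + h * fst w) - h2 v * fst w * Cconj (snd u + h * fst u)
      + (snd u + h * fst u) * (Cconj (h1 v) * Cconj (fst w))
      - (snd w + h * fst w) * (Cconj (h1 v) * Cconj (fst u))))%C).
  { intros v u w.
    destruct (gauduchon_f_wirtinger a c v p Hp) as [A HA].
    eapply is_wirtinger_d01.
    eapply (omega_wirtinger (fun x => RtoC (gauduchon_f n alpha s a c x))
      (fun x => RtoC (Lambda n alpha x)) (fun x => / fst x)%C (hcoef n alpha s) (RtoC c)
      v p u w A (f2 v) _ (l2 v) (z1 v) (h1 v) (h2 v)).
    exact HA. apply Lambda_wirtinger, Hp.
    eapply is_wirtinger_eq.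
    apply (is_wirtinger_inv (V := V2) (fun x : C * C => fst x)). apply is_wirtinger_fst. exact Hp.
    reflexivity. ring.
    apply hcoef_wirtinger, Hp. }
  unfold delbar. rewrite !H. clear H.
  unfold delbar_coef. change (RtoC (weight n alpha (fst p))) with L. fold zi.
  assert (HQ : Cconj (Q (fst p)) = Q (fst p)) by apply Cconj_RtoC.
  assert (Hk : Cconj k2 = k2) by apply Cconj_RtoC.
  assert (H2 : Cconj (/ 2) = (/ 2)%C) by (rewrite <- RtoC_inv by lra; apply Cconj_RtoC).
  assert (HL : Cconj L = L) by apply Cconj_RtoC.
  unfold det3, f2, l2, z1, h1, h2.
  (* Every function value becomes an indeterminate. With the reality of [q'], [k2] and [1/2]
     retained, the claim is a polynomial identity in these values and their conjugates. *)
  clearbody L. clearbody zi. clearbody f. clearbody h. clear f2 l2 z1 h1 h2.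
  destruct p as [z w], u0 as [a0 b0], u1 as [a1 b1], u2 as [a2 b2]. cbn [fst snd] in *.
  generalize dependent (wtilde s (z, w)). intros wt.
  generalize dependent (Q z). generalize dependent (T z). intros t q HQ.
  generalize dependent (dz10 (dz10 s) z). generalize dependent (dz10 s z). intros sz szz.
  generalize dependent (dz01 s z). intros sb.
  generalize dependent (RtoC c). intros c'.
  clearbody k2.
  repeat rewrite ?Cmult_conj, ?Cplus_conj, ?Cminus_conj, ?Copp_conj, ?Cconj_conj, ?HQ, ?Hk, ?H2.
  field.
Qed.

Lemma Ck_delbar_coef (c : R) k : Ck_on (V := C_NormedModule) Cstar k (delbar_coef c).
Proof.
  assert (HO := open_Cstar).
  assert (HT := smooth_d01 (V := C_NormedModule) _ _ (RtoC 1) HO smooth_dz10).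
  apply Ck_mult; trivial. apply Ck_mult; trivial. now apply Ck_const. apply Ck_weight.
  apply Ck_plus; [trivial | apply HT |].
  apply Ck_mult; trivial; [|apply smooth_dz01].
  apply Ck_mult; trivial. apply Ck_Q.
  apply Ck_mult; trivial; [|now apply Ck_const].
  apply (Ck_inv (V := C_NormedModule)); trivial. apply Ck_id.
Qed.

Lemma gauduchon_omega (a c : R) :
  gauduchon (omega n alpha s (gauduchon_f n alpha s a c) c).
Proof.
  intros p Hp u0 u1 u2 u3.
  assert (H : forall v u1 u2 u3 : C * C,
    d10 (V := V2) (fun x => delbar (omega n alpha s (gauduchon_f n alpha s a c) c) x u1 u2 u3) v p
    = (fst v * dz10 (delbar_coef c) (fst p) * det3 u1 u2 u3)%C).
  { intros v w1 w2 w3.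
    eapply is_wirtinger_d10.
    apply (is_wirtinger_ext (V := V2) cover
      (fun x : C * C => delbar_coef c (fst x) * det3 w1 w2 w3)%C).
    apply open_cover. exact Hp. intros q Hq. symmetry. now apply delbar_omega.
    eapply is_wirtinger_eq.
    apply is_wirtinger_mult. apply is_wirtinger_comp_fst. apply Ck_delbar_coef. exact Hp.
    apply is_wirtinger_const. beta_C. ring. reflexivity. }
  (* The alternating sum is a multiple of [dz /\ dw_bar /\ dz /\ dz_bar], in which [dz] is
     repeated. *)
  unfold del. rewrite !H. unfold det3. ring.
Qed.

End Gauduchon.

(** * The Hermitian form and its leafwise flatness *)

Lemma omega_fold (n : nat) (alpha : C) (s : C -> C) (f : C * C -> R) (c : R) p u v :
  omega n alpha s f c p u v =
  (Ci * RtoC (f p) * (zeta p u * Cconj (zeta p v) - zeta p v * Cconj (zeta p u)) +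
   Ci * RtoC c * RtoC (Lambda n alpha p) *
     (eta n alpha s p u * Cconj (eta n alpha s p v)
       - eta n alpha s p v * Cconj (eta n alpha s p u)))%C.
Proof. reflexivity. Qed.

(** The factors 2 arise because a (1,0)-form [a] satisfies [(i a /\ a_bar)(u, I u) = 2 |a(u)|^2]. *)
Definition metric_norm2 (n : nat) (alpha : C) (s : C -> C) (f : C * C ->
  R) (c : R) (p u : C * C) : R :=
  2 * f p * Cmod (zeta p u) ^ 2 + 2 * c * Lambda n alpha p * Cmod (eta n alpha s p u) ^ 2.

Lemma zeta_mulI p u : zeta p (mulI u) = (Ci * zeta p u)%C.
Proof. unfold zeta, dz, mulI; simpl. unfold Cdiv. ring. Qed.

Lemma eta_fold n alpha s p u :
  eta n alpha s p u = (snd u + hcoef n alpha s p * fst u)%C.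
Proof. reflexivity. Qed.

Lemma eta_mulI n alpha s p u : eta n alpha s p (mulI u) = (Ci * eta n alpha s p u)%C.
Proof. rewrite !eta_fold. unfold mulI; simpl. ring. Qed.

Lemma omega_mulI n alpha s f c p u :
  Re (omega n alpha s f c p u (mulI u)) = metric_norm2 n alpha s f c p u.
Proof.
  rewrite omega_fold, zeta_mulI, eta_mulI. unfold metric_norm2. rewrite !Cmod_sqr.
  destruct (zeta p u) as [x y], (eta n alpha s p u) as [x' y']. unfold Re, Im; simpl. ring.
Qed.

Lemma Lambda_pos n alpha p : 0 < Lambda n alpha p.
Proof. apply exp_pos. Qed.

(** [zeta] and [eta] form a coframe: either [zeta] sees [u], or [dz(u) = 0] and [eta(u)] is [dw(u)],
    which is then nonzero. *)
Lemma metric_norm2_pos n alpha s f c p u :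
  cover p -> 0 < f p -> 0 < c -> u <> (RtoC 0, RtoC 0) -> 0 < metric_norm2 n alpha s f c p u.
Proof.
  intros Hp Hf Hc Hu. unfold metric_norm2.
  assert (HL := Lambda_pos n alpha p).
  assert (H1 := pow2_ge_0 (Cmod (zeta p u))). assert (H2 := pow2_ge_0 (Cmod (eta n alpha s p u))).
  assert (HcL : 0 < c * Lambda n alpha p) by now apply Rmult_lt_0_compat.
  destruct (Ceq_dec (fst u) 0) as [E|E].
  - assert (E' : snd u <> 0). { intros E'. apply Hu. destruct u; simpl in *. now subst. }
    rewrite eta_fold, E, Cmult_0_r, Cplus_0_r.
    assert (H3 : 0 < Cmod (snd u) ^ 2) by now apply pow_lt, Cmod_gt_0.
    assert (0 < c * Lambda n alpha p * Cmod (snd u) ^ 2) by now apply Rmult_lt_0_compat.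
    assert (0 <= f p * Cmod (zeta p u) ^ 2) by (apply Rmult_le_pos; lra). lra.
  - assert (E' : zeta p u <> 0).
    { intros E'. apply E. unfold zeta, dz in E'.
      replace (fst u) with (fst u / fst p * fst p)%C by (field; exact Hp). rewrite E'. ring. }
    assert (H3 : 0 < Cmod (zeta p u) ^ 2) by now apply pow_lt, Cmod_gt_0.
    assert (0 < f p * Cmod (zeta p u) ^ 2) by now apply Rmult_lt_0_compat.
    assert (0 <= c * Lambda n alpha p * Cmod (eta n alpha s p u) ^ 2) by (apply Rmult_le_pos; lra).
    lra.
Qed.

Lemma omega_flat n alpha s f c : 0 < c -> flat_along_leaves (omega n alpha s f c).
Proof.
  intros Hc z w Hz. unfold conformal_curvature.
  assert (H : forall x, leaf_metric (omega n alpha s f c) z x = 2 * c * weight n alpha z).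
  { intros x. unfold leaf_metric.
    replace (RtoC 0, Ci) with (mulI (RtoC 0, RtoC 1)) by (unfold mulI; simpl; f_equal; ring).
    rewrite omega_mulI. unfold metric_norm2. rewrite eta_fold.
    unfold zeta, dz; simpl fst; simpl snd.
    replace (0 / z)%C with (RtoC 0) by (unfold Cdiv; ring).
    replace (1 + _)%C with (RtoC 1) by ring. rewrite Cmod_0, Cmod_1.
    change (Lambda n alpha (z, x)) with (weight n alpha z). simpl. ring. }
  rewrite (Derive_n_ext _ (fun _ => ln (2 * c * weight n alpha z)) 2 (Re w)) by (intros;
    now rewrite H).
  rewrite (Derive_n_ext _ (fun _ => ln (2 * c * weight n alpha z)) 2 (Im w)) by (intros;
    now rewrite H).
  rewrite !Derive_n_const. rewrite Rplus_0_r, Ropp_0. apply Rdiv_0_l.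
Qed.

Lemma smooth_wtilde s k :
  smooth_on (V := C_NormedModule) Cstar s -> Ck_on (V := V2) cover k (wtilde s).
Proof.
  intros Hs. apply (Ck_plus (V := V2)). apply open_cover. apply Ck_snd. apply Ck_comp_fst, Hs.
Qed.

Lemma Ck_hcoef n alpha s k :
  smooth_on (V := C_NormedModule) Cstar s -> Ck_on (V := V2) cover k (hcoef n alpha s).
Proof.
  intros Hs. assert (HO := open_cover).
  apply (Ck_plus (V := V2)); trivial.
  - apply (Ck_comp_fst k (dz10 s)), smooth_dz10, Hs.
  - apply (Ck_mult (V := V2)); trivial; [|now apply smooth_wtilde].
    apply (Ck_mult (V := V2)); trivial. apply (Ck_comp_fst k (fun z => RtoC (Derive (qfun n alpha)
      (ln (Cmod z))))).
    apply Ck_Q.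
    apply (Ck_inv (V := V2)); trivial.
    intros p Hp. apply Cmult_neq_0. intros E. apply RtoC_inj in E. lra. exact Hp.
    apply (Ck_mult (V := V2)); trivial. now apply Ck_const. apply Ck_fst.
Qed.

Lemma Ck_Lambda n alpha k : Ck_on (V := V2) cover k (fun p => RtoC (Lambda n alpha p)).
Proof. apply (Ck_comp_fst k (fun z => RtoC (weight n alpha z))), Ck_weight. Qed.

Lemma Ck_zeta k (u : C * C) : Ck_on (V := V2) cover k (fun p => zeta p u).
Proof.
  assert (HO := open_cover).
  apply (Ck_mult (V := V2)); trivial. now apply (Ck_const (V := V2) cover k (fst u)).
  apply (Ck_inv (V := V2)); trivial. apply Ck_fst.
Qed.

Lemma Ck_eta n alpha s k (u : C * C) :
  smooth_on (V := C_NormedModule) Cstar s -> Ck_on (V := V2) cover k (fun p => eta n alpha s p u).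
Proof.
  intros Hs. assert (HO := open_cover).
  apply (Ck_plus (V := V2)); trivial. now apply (Ck_const (V := V2) cover k (snd u)).
  apply (Ck_mult (V := V2)); trivial. now apply Ck_hcoef.
  now apply (Ck_const (V := V2) cover k (fst u)).
Qed.

Lemma Ck_wedge_conj k (a : Form1) (u v : C * C) :
  (forall u, Ck_on (V := V2) cover k (fun p => a p u)) ->
  Ck_on (V := V2) cover k (fun p => wedge a (conj_form a) p u v).
Proof.
  intros Ha. assert (HO := open_cover). unfold wedge, conj_form.
  apply Ck_ext with (fun p : C * C => a p u * Cconj (a p v) + - (1) * (a p v * Cconj (a p u)))%C;
    trivial.
  { intros q _. ring. }
  apply (Ck_plus (V := V2)); trivial.
  apply (Ck_mult (V := V2)); trivial. apply (Ck_conj (V := V2)); trivial.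
  apply (Ck_mult (V := V2)); trivial. now apply Ck_const.
  apply (Ck_mult (V := V2)); trivial. apply (Ck_conj (V := V2)); trivial.
Qed.

Lemma Ck_omega n alpha s f c k (u v : C * C) :
  smooth_on (V := C_NormedModule) Cstar s ->
  Ck_on (V := V2) cover k (fun p => RtoC (f p)) ->
  Ck_on (V := V2) cover k (fun p => omega n alpha s f c p u v).
Proof.
  intros Hs Hf. assert (HO := open_cover).
  apply (Ck_plus (V := V2)); trivial.
  - apply (Ck_mult (V := V2)); trivial. apply (Ck_mult (V := V2)); trivial. now apply Ck_const.
    apply Ck_wedge_conj. apply Ck_zeta.
  - apply (Ck_mult (V := V2)); trivial. apply (Ck_mult (V := V2)); trivial. now apply Ck_const.
    apply Ck_Lambda.
    apply Ck_wedge_conj. intros; now apply Ck_eta.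
Qed.

Lemma omega_hermitian_form n alpha s f c p u v :
     omega n alpha s f c p v u = (- omega n alpha s f c p u v)%C /\
     Im (omega n alpha s f c p u v) = 0 /\
     omega n alpha s f c p (mulI u) (mulI v) = omega n alpha s f c p u v /\
     (forall u', omega n alpha s f c p (plus u u')
       v = (omega n alpha s f c p u v + omega n alpha s f c p u' v)%C) /\
     (forall t : R, omega n alpha s f c p (scal (RtoC t) u)
       v = (RtoC t * omega n alpha s f c p u v)%C).
Proof.
  repeat split.
  - rewrite !omega_fold. ring.
  - rewrite !omega_fold. destruct (zeta p u) as [x y], (eta n alpha s p u) as [x' y'],
    (zeta p v) as [a b], (eta n alpha s p v) as [a' b']. unfold Im; simpl. ring.
  - rewrite !omega_fold, !zeta_mulI, !eta_mulI.
    destruct (zeta p u) as [x y], (eta n alpha s p u) as [x' y'],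
    (zeta p v) as [a b], (eta n alpha s p v) as [a' b'].
    apply injective_projections; simpl; ring.
  - intros u'. rewrite !omega_fold.
    replace (zeta p (plus u u')) with (zeta p u + zeta p u')%C.
    replace (eta n alpha s p (plus u u')) with (eta n alpha s p u + eta n alpha s p u')%C.
    rewrite !Cplus_conj. ring.
    rewrite !eta_fold. destruct u, u'; unfold plus; simpl; unfold plus; simpl. ring.
    unfold zeta, dz. destruct u, u'; unfold plus; simpl; unfold plus, Cdiv; simpl. ring.
  - intros t. rewrite !omega_fold.
    replace (zeta p (scal (RtoC t) u)) with (RtoC t * zeta p u)%C.
    replace (eta n alpha s p (scal (RtoC t) u)) with (RtoC t * eta n alpha s p u)%C.
    rewrite !Cmult_conj, Cconj_RtoC. ring.
    rewrite !eta_fold. destruct u; unfold scal; simpl; unfold scal; simpl; unfold mult; simpl. ring.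
    unfold zeta, dz. destruct u; unfold scal; simpl; unfold scal; simpl; unfold mult, Cdiv; simpl.
    ring.
Qed.

(** * Invariance under the deck transformation *)

(** Complex differentiability in the form of a chain rule along curves, which serves both for the
    lines behind directional derivatives and for arcs moved by the deck transformation. *)
Definition is_holo_derive (g : C -> C) (z g' : C) : Prop :=
  forall (x : R -> C) (t : R) (l : C),
    x t = z -> is_cderive x t l -> is_cderive (fun u => g (x u)) t (l * g')%C.

Lemma is_holo_derive_pow (k : nat) (z : C) :
  is_holo_derive (fun x : C => x ^ k)%C z (RtoC (INR k) * z ^ pred k)%C.
Proof.
  intros x t l Hx Hl. induction k as [|k IH].
  - apply (is_cderive_eq _ _ 0). exact (is_cderive_const (RtoC 1) t). change (INR 0) with 0. ring.
  - apply (is_cderive_eq _ _ (l * x t ^ k + x t * (l * (RtoC (INR k) * z ^ pred k)))%C).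
    exact (is_cderive_mult x (fun u => x u ^ k)%C t _ _ Hl IH).
    rewrite S_INR, RtoC_plus, Hx. simpl pred. clear.
    (* For [k = 0] the truncated exponent [pred 0] is harmless, since the factor [INR 0] kills its
       term. *)
    destruct k as [|k]; [change (INR 0) with 0; simpl Cpow; ring | simpl pred; rewrite Cpow_S;
      ring].
Qed.

(** Continuity of [P'] is recorded because the image of a C^1 arc under [F] must again be a C^1
    arc. *)
Lemma polynomial_holo_derive (n : nat) (P : C -> C) :
  polynomial_of_degree_at_most n P ->
  exists P' : C -> C, (forall z : C, continuous P' z) /\ forall z : C, is_holo_derive P z (P' z).
Proof.
  intros [a Ha].
  assert (H : exists P' : C -> C, (forall z : C, continuous P' z) /\
    forall z : C, is_holo_derive (fun z : C => sum_n (fun k => a k * z ^ k)%C n) z (P' z)).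
  { clear Ha. induction n as [|n [P' [HP' IH]]].
    - exists (fun _ => RtoC 0). split. intros z; apply continuous_const. intros z x t l _ _.
      rewrite Cmult_0_r.
      apply (is_derive_ext (V := C_R_NormedModule) (fun _ => a 0%nat)).
      { intros q. rewrite sum_O. simpl. ring. }
      apply is_cderive_const.
    - exists (fun z => P' z + a (S n) * (RtoC (INR (S n)) * z ^ n))%C. split.
      { intros z. apply continuous_Cplus. apply HP'.
        apply continuous_Cmult. apply continuous_const.
        apply continuous_Cmult. apply continuous_const. apply continuous_Cpow, continuous_id. }
      intros z x t l Hx Hl.
      apply (is_derive_ext (V := C_R_NormedModule)
        (fun u => sum_n (fun k => a k * x u ^ k)%C n + a (S n) * x u ^ S n)%C).
      { intros q. now rewrite sum_Sn. }
      apply (is_cderive_eq _ _ (l * P' z + (0 * x t ^ S n + a (S n) * (l * (RtoC (INR (S n))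
        * z ^ pred (S n)))))%C).
      apply is_cderive_plus. exact (IH z x t l Hx Hl).
      apply (is_cderive_mult (fun _ => a (S n)) (fun u => x u ^ S n)%C). apply is_cderive_const.
      exact (is_holo_derive_pow (S n) z x t l Hx Hl).
      simpl pred; ring. }
  destruct H as [P' [HP' H]]. exists P'. split. exact HP'. intros z x t l Hx Hl.
  apply (is_derive_ext (V := C_R_NormedModule) (fun u => sum_n (fun k => a k * x u ^ k)%C n)).
  intros u; now rewrite Ha. now apply H.
Qed.

Lemma is_wirtinger_holo {V : NormedModule C_AbsRing} (g : C -> C) (h : V ->
  C) (v p : V) (a b g' : C) :
  is_holo_derive g (h p) g' -> is_wirtinger h v p a b ->
  is_wirtinger (fun x => g (h x)) v p (a * g')%C (b * g')%C.
Proof.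
  intros Hg [H1 H2]. split.
  - replace (a * g' + b * g')%C with ((a + b) * g')%C by ring.
    apply Hg; [apply (on_line_0 h) | exact H1].
  - replace (Ci * (a * g' - b * g'))%C with (Ci * (a - b) * g')%C by ring.
    apply Hg; [apply (on_line_0 h) | exact H2].
Qed.

Section Deck.
Variables (n : nat) (alpha : C) (P s : C -> C).
Hypothesis halpha : 0 < Cmod alpha < 1.
Hypothesis hP : polynomial_of_degree_at_most n P.
Hypothesis hs : smooth_on (V := C_NormedModule) Cstar s.
Hypothesis hsF : forall z : C, Cstar z -> s (alpha * z)%C = (z ^ n * s z - P z)%C.

Let F := deck n alpha P.

Lemma ln_alpha_neg : ln (Cmod alpha) < 0.
Proof. rewrite <- ln_1. apply ln_increasing; lra. Qed.

Lemma alpha_neq_0 : alpha <> 0.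
Proof. intros E. rewrite E, Cmod_0 in halpha. lra. Qed.

Lemma deck_cover p : cover p -> cover (F p).
Proof. intros Hp. apply Cmult_neq_0. apply alpha_neq_0. exact Hp. Qed.

Lemma wtilde_deck p : cover p -> wtilde s (F p) = (fst p ^ n * wtilde s p)%C.
Proof. intros Hp. unfold wtilde, F, deck; simpl. rewrite hsF by exact Hp. ring. Qed.

Lemma lnmod_alpha (z : C) : Cstar z -> ln (Cmod (alpha * z)) = ln (Cmod alpha) + ln (Cmod z).
Proof. intros Hz. rewrite Cmod_mult. apply ln_mult. lra. now apply Cmod_gt_0. Qed.

(** This explains the choice of [q]: one has [q(sigma + log|alpha|) = q(sigma) - 2 n sigma]. The
    quadratic term of [q] produces [- 2 n sigma] and a constant [- n log|alpha|], which the linear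
    term [n sigma] compensates. *)
Lemma weight_alpha (z : C) :
  Cstar z -> weight n alpha (alpha * z) * Cmod (z ^ n) ^ 2 = weight n alpha z.
Proof.
  intros Hz. unfold weight. rewrite lnmod_alpha, Cmod_pow by exact Hz.
  assert (Hm : 0 < Cmod z) by now apply Cmod_gt_0.
  replace (Cmod z ^ n) with (exp (INR n * ln (Cmod z))) by (rewrite <- Rpower_pow by exact Hm;
    reflexivity).
  simpl. rewrite Rmult_1_r, <- !exp_plus. f_equal. unfold qfun.
  field. apply Rlt_not_eq, ln_alpha_neg.
Qed.

Lemma Lambda_deck p : cover p -> Lambda n alpha (F p) * Cmod (fst p ^ n) ^ 2 = Lambda n alpha p.
Proof. exact (weight_alpha (fst p)). Qed.

Lemma qprime_alpha (z : C) :
  Cstar z -> Derive (qfun n alpha) (ln (Cmod (alpha * z))) = Derive (qfun n alpha) (ln (Cmod z))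
    - 2 * INR n.
Proof.
  intros Hz. rewrite lnmod_alpha, !Derive_qfun by exact Hz.
  field. apply Rlt_not_eq, ln_alpha_neg.
Qed.

(* Both sides differentiate [z |-> s (alpha z)]. *)
Lemma s_alpha_wirtinger (z P' : C) :
  Cstar z -> is_holo_derive P z P' ->
  (alpha * dz10 s (alpha * z) = RtoC (INR n) * z ^ pred n * s z + z ^ n * dz10 s z - P')%C /\
  (Cconj alpha * dz01 s (alpha * z) = z ^ n * dz01 s z)%C.
Proof.
  intros Hz HP.
  assert (H1 : is_wirtinger (V := C_NormedModule) (fun x : C => s (alpha * x)%C) (RtoC 1) z
     (alpha * dz10 s (alpha * z))%C (Cconj alpha * dz01 s (alpha * z))%C).
  { assert (Hz' : Cstar (alpha * z)) by (apply Cmult_neq_0; [apply alpha_neq_0 | exact Hz]).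
    (* Multiplication by [alpha] carries the line through [z] in the direction 1 to the line through
       [alpha z] in the direction [alpha]. *)
    destruct (plane_wirtinger s alpha (alpha * z) (hs 1%nat) Hz') as [H1 H2].
    split; (eapply (is_derive_ext (V := C_R_NormedModule)); [|eassumption]);
    intros t; unfold on_line; f_equal; unfold plus, scal; simpl; unfold mult; simpl; ring. }
  assert (H2 : is_wirtinger (V := C_NormedModule) (fun x : C => s (alpha * x)%C) (RtoC 1) z
     (RtoC (INR n) * z ^ pred n * s z + z ^ n * dz10 s z - P')%C (z ^ n * dz01 s z)%C).
  { apply (is_wirtinger_ext (V := C_NormedModule) Cstar (fun z : C => z ^ n * s z - P z)%C).
    apply open_Cstar. exact Hz. intros q Hq. symmetry. now apply hsF.
    eapply is_wirtinger_eq. apply (is_wirtinger_minus (V := C_NormedModule)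
      (fun z : C => z ^ n * s z)%C P).
    apply (is_wirtinger_mult (V := C_NormedModule) (fun z : C => z ^ n)%C s).
    apply (is_wirtinger_holo (V := C_NormedModule) (fun z : C => z ^ n)%C (fun x : C => x)).
    apply is_holo_derive_pow. apply is_wirtinger_id.
    apply plane_wirtinger. apply hs. exact Hz.
    apply (is_wirtinger_holo (V := C_NormedModule) P (fun x : C => x)). exact HP.
    apply is_wirtinger_id.
    beta_C. ring. rewrite Cconj_RtoC. beta_C. ring. }
  split.
  - now rewrite <- (is_wirtinger_d10 _ _ _ _ _ H1), (is_wirtinger_d10 _ _ _ _ _ H2).
  - now rewrite <- (is_wirtinger_d01 _ _ _ _ _ H1), (is_wirtinger_d01 _ _ _ _ _ H2).
Qed.

Definition deck_differential (P' : C) (p v : C * C) : C * C :=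
  ((alpha * fst v)%C,
   (fst v * (RtoC (INR n) * fst p ^ pred n) * snd p + fst p ^ n * snd v + fst v * P')%C).

Lemma deck_wirtinger (P' : C) (p v : C * C) :
  is_holo_derive P (fst p) P' ->
  is_wirtinger (V := V2) (fun q : C * C => fst (F q)) v p (fst (deck_differential P' p v)) 0 /\
  is_wirtinger (V := V2) (fun q : C * C => snd (F q)) v p (snd (deck_differential P' p v)) 0.
Proof.
  intros HP. split.
  - eapply is_wirtinger_eq. apply (is_wirtinger_scal (V := V2) alpha (fun x : C * C => fst x)).
    apply is_wirtinger_fst. reflexivity. ring.
  - eapply is_wirtinger_eq. apply (is_wirtinger_plus (V := V2)
      (fun q : C * C => fst q ^ n * snd q)%C (fun q : C * C => P (fst q))).
    apply (is_wirtinger_mult (V := V2) (fun q : C * C => fst q ^ n)%C (fun x : C * C => snd x)).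
    apply (is_wirtinger_holo (V := V2) (fun z : C => z ^ n)%C (fun x : C * C => fst x)).
    apply is_holo_derive_pow. apply is_wirtinger_fst.
    apply is_wirtinger_snd.
    apply (is_wirtinger_holo (V := V2) P (fun x : C * C => fst x)). exact HP.
    apply is_wirtinger_fst.
    unfold deck_differential. beta_C. simpl. ring. beta_C. ring.
Qed.

Lemma zeta_deck (P' : C) (p v : C * C) :
  cover p -> zeta (F p) (deck_differential P' p v) = zeta p v.
Proof.
  intros Hp. unfold zeta, dz, F, deck, deck_differential; simpl. field.
  split. exact Hp. apply alpha_neq_0.
Qed.

(** Differentiating [z^n] in [F] and in [s(alpha z)] yields [n z^(n-1) (w + s) dz]. It is cancelled
    by the shift of [q'] by [- 2 n], which is divided by [2 z] and multiplied by [z^n wtilde]; the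
    two occurrences of [P'] cancel as well. *)
Lemma eta_deck (P' : C) (p v : C * C) :
  cover p -> is_holo_derive P (fst p) P' ->
  eta n alpha s (F p) (deck_differential P' p v) = (fst p ^ n * eta n alpha s p v)%C.
Proof.
  intros Hp HP. destruct (s_alpha_wirtinger (fst p) P' Hp HP) as [H _].
  rewrite !eta_fold. unfold hcoef. rewrite wtilde_deck by exact Hp.
  replace (fst (F p)) with (alpha * fst p)%C by reflexivity.
  rewrite qprime_alpha by exact Hp. rewrite RtoC_minus, RtoC_mult.
  assert (E : dz10 s (alpha * fst p)%C = ((RtoC (INR n) * fst p ^ pred n * s (fst p)
    + fst p ^ n * dz10 s (fst p) - P') / alpha)%C).
  { rewrite <- H. field. apply alpha_neq_0. }
  assert (Hn : (RtoC (INR n) * fst p ^ pred n = RtoC (INR n) * fst p ^ n / fst p)%C).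
  { destruct n as [|m]; [change (INR 0) with 0; simpl; field; exact Hp | simpl pred;
      rewrite Cpow_S; field; exact Hp]. }
  rewrite E. unfold deck_differential, wtilde; cbn [fst snd]. rewrite Hn. field. split. exact Hp.
  apply alpha_neq_0.
Qed.

Lemma omega_deck f c (P' : C) (p u v : C * C) :
  cover p -> is_holo_derive P (fst p) P' ->
  f (F p) = f p ->
  omega n alpha s f c (F p) (deck_differential P' p u) (deck_differential P' p v)
  = omega n alpha s f c p u v.
Proof.
  intros Hp HP Hf. rewrite !omega_fold, !zeta_deck, !eta_deck, Hf by assumption.
  rewrite <- (Lambda_deck p Hp), RtoC_mult, Cmod2_conj, !Cmult_conj. ring.
Qed.

Lemma omega_pullback f c p u v :
  cover p -> f (F p) = f p ->
  pullback F (omega n alpha s f c) p u v = omega n alpha s f c p u v.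
Proof.
  intros Hp Hf. destruct (polynomial_holo_derive n P hP) as [P' [_ HP]].
  assert (HP' := HP (fst p)).
  rewrite <- (omega_deck f c _ p u v Hp HP' Hf). unfold pullback.
  assert (E : forall x : C * C,
   (dderiv (V := V2) (fun q => fst (F q)) x p,
     dderiv (V := V2) (fun q => snd (F q)) x p) = deck_differential (P' (fst p)) p x).
  { intros x. destruct (deck_wirtinger _ p x HP') as [[H1 _] [H2 _]].
    apply injective_projections; simpl.
    etransitivity; [exact (dderiv_unique _ _ _ _ H1) | simpl; ring].
    etransitivity; [exact (dderiv_unique _ _ _ _ H2) | simpl; ring]. }
  now rewrite !E.
Qed.

Lemma omega_hermitian f c :
  positive_smooth_on_A F f -> 0 < c -> hermitian_metric_on_A F (omega n alpha s f c).
Proof.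
  intros [Hf1 [Hf2 Hf3]] Hc. split; [|split; [|split]].
  - intros u v k. apply Ck_omega. exact hs. apply Hf1.
  - intros p _ u v. apply omega_hermitian_form.
  - intros p Hp u Hu. rewrite omega_mulI. apply metric_norm2_pos; auto.
  - intros p Hp u v. apply omega_pullback; auto.
Qed.

(** As [log|alpha| < 0], the coefficient of [Lambda |wtilde|^2] is nonnegative, so [f >= a] and this
    [f] also has a positive infimum. Invariance holds because the factors [|z|^(-2n)] of [Lambda]
    and [|z|^(2n)] of [|wtilde|^2] cancel. *)
Lemma gauduchon_f_positive_smooth a c :
  0 < a -> 0 < c -> positive_smooth_on_A F (gauduchon_f n alpha s a c).
Proof.
  intros Ha Hc. split; [|split].
  - intros k.
    apply (Ck_ext (V := V2) cover k (fun x : C * C => RtoC a + RtoC (- (INR n / (2 * ln (Cmod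
      alpha)) * c)) * (RtoC (Lambda n alpha x) * (wtilde s x * Cconj (wtilde s x))))%C).
    apply open_cover.
    { intros q _. unfold gauduchon_f. rewrite <- Cmod2_conj, <- !RtoC_mult, <- RtoC_plus. f_equal.
      ring. }
    assert (HO := open_cover). pose proof (smooth_wtilde s k hs).
    apply (Ck_plus (V := V2)); trivial. now apply Ck_const.
    apply (Ck_mult (V := V2)); trivial. now apply Ck_const.
    apply (Ck_mult (V := V2)); trivial. apply Ck_Lambda.
    apply (Ck_mult (V := V2)); trivial. now apply Ck_conj.
  - intros p Hp. unfold gauduchon_f.
    assert (H1 := ln_alpha_neg). assert (H2 := pos_INR n).
    assert (H3 := Lambda_pos n alpha p). assert (H4 := pow2_ge_0 (Cmod (wtilde s p))).
    assert (H5 : 0 <= - (INR n / (2 * ln (Cmod alpha)))).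
    { unfold Rdiv. rewrite <- Ropp_mult_distr_r_reverse. apply Rmult_le_pos. exact H2.
      rewrite <- Rinv_opp. apply Rlt_le, Rinv_0_lt_compat. lra. }
    assert (H6 : 0 <= - (INR n / (2 * ln (Cmod alpha))) * c * Lambda n alpha p * Cmod (wtilde s p)
      ^ 2).
    { apply Rmult_le_pos; [apply Rmult_le_pos; [apply Rmult_le_pos |] |]; lra. }
    lra.
  - intros p Hp. unfold gauduchon_f. f_equal.
    rewrite wtilde_deck, Cmod_mult, <- (Lambda_deck p) by exact Hp. simpl. ring.
Qed.
End Deck.

(** * Lengths of arcs *)

Notation RC2 := (prod_NormedModule R_AbsRing C_R_NormedModule C_R_NormedModule).

Lemma is_derive_C2_iff (g : R -> C * C) (t : R) (l : C * C) :
  is_derive (V := RC2) g t l <->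
  is_cderive (fun x => fst (g x)) t (fst l) /\ is_cderive (fun x => snd (g x)) t (snd l).
Proof.
  split.
  - intros H; split.
    + apply (filterdiff_comp (V := RC2) (W := C_R_NormedModule) g fst (fun y => scal y l) fst).
      exact H. apply filterdiff_linear, is_linear_fst.
    + apply (filterdiff_comp (V := RC2) (W := C_R_NormedModule) g snd (fun y => scal y l) snd).
      exact H. apply filterdiff_linear, is_linear_snd.
  - intros [H1 H2].
    assert (L1 : is_linear (U := C_R_NormedModule) (V := RC2) (fun x => (x, zero))).
    { split.
      - intros x y. apply injective_projections; simpl. reflexivity.
        symmetry; apply (plus_zero_l (G := C_R_NormedModule)).
      - intros k x. apply injective_projections; simpl. reflexivity.
        symmetry; apply (scal_zero_r (V := C_R_NormedModule)).
      (* [sqrt 2] is the constant of [norm_prod], which compares the product norm with the larger of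
         the two component norms. *)
      - exists (sqrt 2). split. apply Rlt_sqrt2_0. intros x.
        eapply Rle_trans. apply (norm_prod (U := C_R_NormedModule) (V := C_R_NormedModule)).
        rewrite (@norm_zero _ C_R_NormedModule).
        rewrite Rmax_left by apply (norm_ge_0 (V := C_R_NormedModule)). apply Rle_refl. }
    assert (L2 : is_linear (U := C_R_NormedModule) (V := RC2) (fun x => (zero, x))).
    { split.
      - intros x y. apply injective_projections; simpl.
        symmetry; apply (plus_zero_l (G := C_R_NormedModule)). reflexivity.
      - intros k x. apply injective_projections; simpl.
        symmetry; apply (scal_zero_r (V := C_R_NormedModule)). reflexivity.
      - exists (sqrt 2). split. apply Rlt_sqrt2_0. intros x.
        eapply Rle_trans. apply (norm_prod (U := C_R_NormedModule) (V := C_R_NormedModule)).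
        rewrite (@norm_zero _ C_R_NormedModule).
        rewrite Rmax_right by apply (norm_ge_0 (V := C_R_NormedModule)). apply Rle_refl. }
    pose proof (filterdiff_comp (V := C_R_NormedModule) (W := RC2)
      _ _ _ _ H1 (filterdiff_linear _ L1)) as D1.
    pose proof (filterdiff_comp (V := C_R_NormedModule) (W := RC2)
      _ _ _ _ H2 (filterdiff_linear _ L2)) as D2.
    pose proof (filterdiff_plus_fct _ _ _ _ D1 D2) as D.
    eapply (filterdiff_ext_lin _ _).
    + eapply (filterdiff_ext (V := RC2)); [|exact D].
      intros x; simpl. destruct (g x) as [a b]. apply injective_projections; simpl.
      apply (plus_zero_r (G := C_R_NormedModule)). apply (plus_zero_l (G := C_R_NormedModule)).
    + intros x; simpl. destruct l as [a b]. apply injective_projections; simpl.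
      apply (plus_zero_r (G := C_R_NormedModule)). apply (plus_zero_l (G := C_R_NormedModule)).
Qed.

Definition C2U := prod_UniformSpace C_UniformSpace C_UniformSpace.

Lemma continuous_C2_fst {U : UniformSpace} (g : U -> C * C) x :
  continuous (U := C2U) g x -> continuous (fun y => fst (g y)) x.
Proof. intros H. apply (continuous_comp (V := C2U) g fst). exact H. destruct (g x).
apply continuous_fst. Qed.

Lemma continuous_C2_snd {U : UniformSpace} (g : U -> C * C) x :
  continuous (U := C2U) g x -> continuous (fun y => snd (g y)) x.
Proof. intros H. apply (continuous_comp (V := C2U) g snd). exact H. destruct (g x).
apply continuous_snd. Qed.

Lemma continuous_C2_pair {U : UniformSpace} (g : U -> C * C) x :
  continuous (fun y => fst (g y)) x -> continuous (fun y => snd (g y)) x ->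
    continuous (U := C2U) g x.
Proof.
  intros H1 H2 P [eps HP].
  destruct (proj1 (filterlim_locally _ _) H1 eps) as [d1 Hd1].
  destruct (proj1 (filterlim_locally _ _) H2 eps) as [d2 Hd2].
  exists (mkposreal _ (Rmin_stable_in_posreal d1 d2)). intros y Hy.
  apply HP. split.
  apply Hd1. eapply ball_le; [|exact Hy]. apply Rmin_l.
  apply Hd2. eapply ball_le; [|exact Hy]. apply Rmin_r.
Qed.

Section Metric.
Variables (n : nat) (alpha : C) (s : C -> C) (f : C * C -> R) (c : R).
Hypothesis hs : smooth_on (V := C_NormedModule) Cstar s.
Hypothesis hf : forall p, cover p -> continuous (T := C2U) f p.

Let N := metric_norm2 n alpha s f c.

(** Point and vector vary together over an arbitrary space: the real line for the speed of an arc,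
    pairs of a point and a vector for the length of short segments. *)
Lemma continuous_metric_norm2 {U : UniformSpace} (x v : U -> C * C) (t : U) :
  continuous (U := C2U) x t -> continuous (U := C2U) v t -> cover (x t) ->
  continuous (fun y => N (x y) (v y)) t.
Proof.
  intros Hx Hv Hp.
  assert (Hx1 := continuous_C2_fst x t Hx).
  assert (Hv1 := continuous_C2_fst v t Hv). assert (Hv2 := continuous_C2_snd v t Hv).
  assert (Hf : continuous (fun y => f (x y)) t) by (apply (continuous_comp (V := C2U) x f); auto).
  assert (HL : continuous (fun y => Lambda n alpha (x y)) t).
  { apply (continuous_comp (V := C2U) x (Lambda n alpha)); trivial.
    apply continuous_RtoC. exact (Ck_continuous (V := V2) _ 0 _ _ (Ck_Lambda n alpha 0) Hp). }
  assert (Hh : continuous (fun y => hcoef n alpha s (x y)) t).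
  { apply (continuous_comp (V := C2U) x (hcoef n alpha s)); trivial.
    exact (Ck_continuous (V := V2) _ 0 _ _ (Ck_hcoef n alpha s 0 hs) Hp). }
  unfold N, metric_norm2. apply continuous_Rplus.
  - apply continuous_Rmult. apply continuous_Rmult. apply continuous_const. exact Hf.
    apply continuous_Cmod_sqr. unfold zeta, dz. apply continuous_Cmult. exact Hv1.
    now apply continuous_Cinv.
  - apply continuous_Rmult. apply continuous_Rmult. apply continuous_const. exact HL.
    apply continuous_Cmod_sqr. apply continuous_ext with (fun y => snd (v y)
      + hcoef n alpha s (x y) * fst (v y))%C.
    reflexivity.
    apply continuous_Cplus. exact Hv2. apply continuous_Cmult; assumption.
Qed.

Lemma metric_norm2_ge_0 p u : cover p -> 0 <= f p -> 0 <= c -> 0 <= N p u.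
Proof.
  intros Hp Hf Hc. unfold N, metric_norm2. assert (HL := Lambda_pos n alpha p).
  apply Rplus_le_le_0_compat; (apply Rmult_le_pos; [|apply pow2_ge_0]);
  repeat (apply Rmult_le_pos; [|lra]); lra.
Qed.

Lemma arc_length_eq g dg :
  arc_length (omega n alpha s f c) g dg = RInt (fun t => sqrt (N (g t) (dg t))) 0 1.
Proof. apply RInt_ext. intros t _. now rewrite omega_mulI. Qed.

Lemma C1_arc_continuous g dg t : C1_arc g dg -> continuous (U := C2U) g t.
Proof.
  intros [H _]. apply (ex_derive_continuous (V := RC2)). eexists; apply H.
Qed.

Hypothesis hfpos : forall p, cover p -> 0 < f p.
Hypothesis hc : 0 < c.

Lemma continuous_speed g dg t :
  C1_arc g dg -> 0 <= t <= 1 -> continuous (fun t => sqrt (N (g t) (dg t))) t.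
Proof.
  intros Hg Ht.
  apply (continuous_comp (fun t => N (g t) (dg t)) sqrt).
  - apply continuous_metric_norm2. now apply C1_arc_continuous with dg. apply Hg. now apply Hg.
  - apply continuity_pt_filterlim. apply continuity_pt_sqrt, metric_norm2_ge_0.
    now apply Hg. apply Rlt_le, hfpos. now apply Hg. lra.
Qed.

Lemma ex_RInt_speed g dg :
  C1_arc g dg -> ex_RInt (fun t => sqrt (N (g t) (dg t))) 0 1.
Proof.
  intros Hg. apply (ex_RInt_continuous (V := R_CompleteNormedModule)).
  rewrite Rmin_left, Rmax_right by lra. intros t. now apply continuous_speed.
Qed.

(* [eta] is the (1,0) part of the covariant derivative of the section [wtilde] for the
   Hermitian metric [Lambda], and [conj(dz) ds/dz_bar] its (0,1) part. *)
Definition fibre_norm2 (p : C * C) : R := Lambda n alpha p * Cmod (wtilde s p) ^ 2.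

(** Compatibility of the Chern connection with its metric: the derivative [Lambda q' Re zeta] of
    [Lambda] is absorbed by the summand [q' / (2 z) wtilde dz] of [eta]. *)
Lemma fibre_norm2_derive (g : R -> C * C) (dg : C * C) t :
  cover (g t) -> is_derive (V := RC2) g t dg ->
  is_derive (fun x => fibre_norm2 (g x)) t
    (2 * Lambda n alpha (g t) *
      Re (Cconj (wtilde s (g t)) * (eta n alpha s (g t) dg + Cconj (fst dg) * dz01 s (fst (g t))))).
Proof.
  intros Hp [Hz Hw]%is_derive_C2_iff.
  assert (HL : is_derive (fun x => Lambda n alpha (g x)) t
    (Lambda n alpha (g t) * (Derive (qfun n alpha) (ln (Cmod (fst (g t))))
      * Re (fst dg / fst (g t))))).
  { pose proof (is_derive_lnmod _ _ _ Hz Hp) as H1.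
    assert (H2 : is_derive (qfun n alpha) (ln (Cmod (fst (g t)))) (Derive (qfun n alpha)
      (ln (Cmod (fst (g t)))))).
    { apply Derive_correct. unfold qfun. auto_derive. trivial. }
    pose proof (is_derive_comp (qfun n alpha) (fun x => ln (Cmod (fst (g x)))) _ _ _ H2 H1) as H3.
    pose proof (is_derive_comp exp (fun x => qfun n alpha (ln (Cmod (fst (g x)))))
      _ _ _ (is_derive_exp _) H3) as H4.
    evar_last. exact H4. unfold scal; simpl; unfold mult; simpl. unfold Lambda. ring. }
  pose proof (is_cderive_plus _ _ _ _ _ Hw
    (is_cderive_comp_d Cstar s open_Cstar (hs 1%nat) _ _ _ Hz Hp)) as Hwt.
  change (is_cderive (fun x => wtilde s (g x)) t
    (snd dg + (fst dg * dz10 s (fst (g t)) + Cconj (fst dg) * dz01 s (fst (g t))))%C) in Hwt.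
  apply is_cderive_iff in Hwt as [Hr Hi].
  pose proof (is_derive_mult _ _ _ _ _ HL (is_derive_normsq _ _ _ _ _ Hr Hi) Rmult_comm) as H.
  eapply (is_derive_ext (V := R_NormedModule)) in H.
  2: { intros x. transitivity (fibre_norm2 (g x)); [|reflexivity]. unfold fibre_norm2.
  rewrite Cmod_sqr.
       unfold mult; simpl. ring. }
  evar_last. exact H. clear H Hr Hi HL.
  replace (eta n alpha s (g t) dg) with
    (snd dg + dz10 s (fst (g t)) * fst dg +
     RtoC (Derive (qfun n alpha) (ln (Cmod (fst (g t)))) / 2) * (fst dg / fst (g t))
       * wtilde s (g t))%C.
  2: { rewrite eta_fold. unfold hcoef. rewrite RtoC_div by lra. field. exact Hp. }
  generalize (fst dg / fst (g t))%C as z. generalize (Derive (qfun n alpha)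
    (ln (Cmod (fst (g t))))) as q.
  generalize (Lambda n alpha (g t)) as L. generalize (wtilde s (g t)) as w.
  generalize (dz10 s (fst (g t))) as a. generalize (dz01 s (fst (g t))) as b.
  clear. intros b a w L q z. destruct dg as [l m]. simpl fst; simpl snd.
  destruct a as [a1 a2], b as [b1 b2], w as [w1 w2], z as [z1 z2], l as [l1 l2], m as [m1 m2].
  unfold plus, mult, Re, Im; simpl. field.
Qed.

Lemma le_sqrt_of_sqr_le (x y : R) : x * x <= y -> x <= sqrt y.
Proof.
  intros H. eapply Rle_trans. apply Rle_abs. rewrite <- (sqrt_Rsqr_abs x).
  now apply sqrt_le_1_alt.
Qed.

Lemma Re_sqr_le (z : C) : Re z * Re z <= Cmod z ^ 2.
Proof. rewrite Cmod_sqr. assert (0 <= Im z * Im z) by apply Rle_0_sqr. lra. Qed.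

Lemma Cmod_plus_sqr_le (a b : C) : Cmod (a + b) ^ 2 <= 2 * Cmod a ^ 2 + 2 * Cmod b ^ 2.
Proof.
  assert (H := Cmod_triangle a b). assert (H1 := Cmod_ge_0 a). assert (H2 := Cmod_ge_0 b).
  assert (H3 := Cmod_ge_0 (a + b)).
  apply Rle_trans with ((Cmod a + Cmod b) ^ 2). apply pow_incr; lra.
  assert (H4 := pow2_ge_0 (Cmod a - Cmod b)). lra.
Qed.

Variables (m B : R).
Hypothesis hm : 0 < m.
Hypothesis hmf : forall p, cover p -> m <= f p.
Hypothesis hB : forall z, Cstar z -> weight n alpha z * Cmod (dz01 s z) ^ 2 * Cmod z ^ 2 <= B.

Lemma growth_constant_ge_0 : 0 <= / c + B / m.
Proof.
  assert (HB : 0 <= B).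
  { eapply Rle_trans; [|apply (hB 1)]. apply Rmult_le_pos. apply Rmult_le_pos.
    apply Rlt_le, exp_pos. apply pow2_ge_0. apply pow2_ge_0. apply C1_nz. }
  apply Rplus_le_le_0_compat. apply Rlt_le, Rinv_0_lt_compat, hc. apply Rdiv_le_0_compat; lra.
Qed.

(** Cauchy-Schwarz leaves [Lambda |eta + conj(dz) ds/dz_bar|^2 <= 2 Lambda |eta|^2 + 2 B |zeta|^2].
    Against the metric, [1/c] pays for the first term and, as [f >= m], [B/m] for the second. Adding
    the two constants costs only nonnegative cross terms. *)
Lemma fibre_norm2_derive_bound p v :
  cover p ->
  (2 * Lambda n alpha p * Re (Cconj (wtilde s p) * (eta n alpha s p v + Cconj (fst v)
    * dz01 s (fst p)))) ^ 2
  <= 4 * fibre_norm2 p * ((/ c + B / m) * N p v).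
Proof.
  intros Hp. assert (HL := Lambda_pos n alpha p).
  set (X := (eta n alpha s p v + Cconj (fst v) * dz01 s (fst p))%C).
  assert (H1 := Re_sqr_le (Cconj (wtilde s p) * X)). rewrite Cmod_mult, Cmod_conj in H1.
  assert (H2 := Cmod_plus_sqr_le (eta n alpha s p v) (Cconj (fst v) * dz01 s (fst p))).
  fold X in H2.
  rewrite Cmod_mult, Cmod_conj in H2.
  assert (Hv : Cmod (fst v) = Cmod (fst p) * Cmod (zeta p v)).
  { rewrite <- Cmod_mult. f_equal. unfold zeta, dz. field. exact Hp. }
  rewrite Hv in H2.
  assert (HB := hB (fst p) Hp). change (weight n alpha (fst p)) with (Lambda n alpha p) in HB.
  assert (HN : 2 * m * Cmod (zeta p v) ^ 2 + 2 * c * (Lambda n alpha p * Cmod (eta n alpha s p v)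
    ^ 2) <= N p v).
  { unfold N, metric_norm2. assert (H := hmf p Hp). assert (H0 := pow2_ge_0 (Cmod (zeta p v))).
    assert (0 <= (f p - m) * Cmod (zeta p v) ^ 2) by (apply Rmult_le_pos; lra). lra. }
  unfold fibre_norm2.
  set (L := Lambda n alpha p) in *. set (E := Cmod (eta n alpha s p v)) in *.
  set (Z := Cmod (zeta p v)) in *. set (W := Cmod (wtilde s p)) in *.
  set (b := Cmod (dz01 s (fst p))) in *. set (z := Cmod (fst p)) in *.
  assert (HE := pow2_ge_0 E). assert (HZ := pow2_ge_0 Z).
  assert (HW := pow2_ge_0 W).
  assert (HB0 : 0 <= B). { eapply Rle_trans; [|exact HB]. apply Rmult_le_pos. apply Rmult_le_pos.
  lra. apply pow2_ge_0. apply pow2_ge_0. }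
  assert (H3 : L * Cmod X ^ 2 <= (/ c + B / m) * N p v).
  { apply Rle_trans with (2 * (L * E ^ 2) + 2 * B * Z ^ 2).
    - assert (H := Rmult_le_compat_l L _ _ (Rlt_le _ _ HL) H2).
      assert (H' := Rmult_le_compat_r (Z ^ 2) _ _ HZ HB). simpl in *. lra.
    - assert (Hl : 0 <= L * E ^ 2) by (apply Rmult_le_pos; lra).
      apply Rle_trans with ((/ c + B / m) * (2 * m * Z ^ 2 + 2 * c * (L * E ^ 2))).
      + replace ((/ c + B / m) * (2 * m * Z ^ 2 + 2 * c * (L * E ^ 2))) with
          (2 * (L * E ^ 2) + 2 * B * Z ^ 2 + (2 * m * / c * Z ^ 2 + 2 * c * (B / m) * (L * E ^ 2))).
        2: { field. lra. }
        assert (0 <= 2 * m * / c * Z ^ 2).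
        { apply Rmult_le_pos; [|lra]. apply Rmult_le_pos. lra. apply Rlt_le, Rinv_0_lt_compat, hc. }
        assert (0 <= 2 * c * (B / m) * (L * E ^ 2)).
        { apply Rmult_le_pos; [|lra]. apply Rmult_le_pos. lra. apply Rdiv_le_0_compat; lra. }
        lra.
      + apply Rmult_le_compat_l; [|exact HN].
        apply Rplus_le_le_0_compat. apply Rlt_le, Rinv_0_lt_compat, hc.
        apply Rdiv_le_0_compat; lra. }
  set (r := Re _) in *.
  apply Rle_trans with (4 * (L * L) * (W * Cmod X) ^ 2).
  - replace ((2 * L * r) ^ 2) with (4 * (L * L) * (r * r)) by ring.
    apply Rmult_le_compat_l; [|exact H1]. assert (0 <= L * L) by apply Rle_0_sqr. lra.
  - replace (4 * (L * L) * (W * Cmod X) ^ 2) with (4 * (L * W ^ 2) * (L * Cmod X ^ 2)) by ring.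
    apply Rmult_le_compat_l; [|exact H3]. assert (0 <= L * W ^ 2) by (apply Rmult_le_pos; lra). lra.
Qed.

(** The mean value theorem for a primitive of [h] minus [phi] asks for no integrability of [phi'].
    As [h] is controlled on [[0, 1]] only, it is first extended to a continuous function on the
    line, so that its primitive is differentiable at the end points too. *)
Lemma increment_le_RInt (phi phi' h : R -> R) :
  (forall t, 0 <= t <= 1 -> is_derive phi t (phi' t) /\ phi' t <= h t /\ continuous h t) ->
  phi 1 - phi 0 <= RInt h 0 1.
Proof.
  intros H.
  destruct (C0_extension_le h 0 1) as [g [Hg1 Hg2]]. intros t Ht; now apply H.
  assert (Hex : forall a b, ex_RInt g a b).
  { intros a b. apply (ex_RInt_continuous (V := R_CompleteNormedModule)). intros; apply Hg1. }
  rewrite (RInt_ext h g).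
  2: { intros t Ht. rewrite Rmin_left, Rmax_right in Ht by lra. symmetry; apply Hg2; lra. }
  assert (HG : forall t, is_derive (fun t => RInt g 0 t) t (g t)).
  { intros t. apply is_derive_RInt with 0; [|apply Hg1].
    apply filter_forall. intros x. apply (RInt_correct (V := R_CompleteNormedModule)), Hex. }
  destruct (MVT_gen (fun t => RInt g 0 t - phi t) 0 1 (fun t => g t - phi' t)) as [t [Ht E]].
  - rewrite Rmin_left, Rmax_right by lra. intros t Ht.
    apply (is_derive_minus (V := R_NormedModule)). apply HG. apply H; lra.
  - rewrite Rmin_left, Rmax_right by lra. intros t Ht.
    apply continuity_pt_filterlim. apply (ex_derive_continuous (V := R_NormedModule)
      (fun t => RInt g 0 t - phi t)). exists (g t - phi' t).
    apply (is_derive_minus (V := R_NormedModule) (fun t => RInt g 0 t) phi). apply HG.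
    exact (proj1 (H t Ht)).
  - rewrite Rmin_left, Rmax_right in Ht by lra. destruct (H t Ht) as [_ [H1 _]].
    rewrite <- (Hg2 t Ht) in H1. rewrite (RInt_point (V := R_CompleteNormedModule)) in E.
    unfold zero in E; simpl in E. lra.
Qed.

(* The summand 1 makes the square root differentiable on the zero section. *)
Definition height (p : C * C) : R := sqrt (1 + fibre_norm2 p).

Lemma fibre_norm2_ge_0 p : 0 <= fibre_norm2 p.
Proof. apply Rmult_le_pos. apply Rlt_le, Lambda_pos. apply pow2_ge_0. Qed.

(** The derivative of [height] is that of [fibre_norm2] divided by [2 height], and
    [fibre_norm2 <= height^2]. Hence the factor [fibre_norm2] in the squared bound disappears and
    the Lipschitz constant is the same at all points. *)
Lemma height_arc g dg :
  C1_arc g dg ->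
  height (g 1) <= height (g 0) + sqrt (/ c + B / m) * arc_length (omega n alpha s f c) g dg.
Proof.
  intros Hg. rewrite arc_length_eq.
  set (d := fun t => 2 * Lambda n alpha (g t) *
      Re (Cconj (wtilde s (g t)) * (eta n alpha s (g t) (dg t) + Cconj (fst (dg t))
        * dz01 s (fst (g t))))).
  assert (H : height (g 1) - height (g 0) <= RInt (fun t => scal (sqrt (/ c + B / m))
    (sqrt (N (g t) (dg t)))) 0 1).
  { apply (increment_le_RInt (fun t => height (g t)) (fun t => d t / (2 * height (g t)))).
    intros t Ht. assert (Hp : cover (g t)) by now apply Hg.
    assert (H0 := fibre_norm2_ge_0 (g t)).
    split; [|split].
    - apply is_derive_sqrt; [|lra].
      evar_last. apply (is_derive_plus (V := R_NormedModule)).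
      apply (is_derive_const (V := R_NormedModule)).
      apply fibre_norm2_derive. exact Hp. apply Hg.
      exact (Rplus_0_l _).
    - assert (Hh : height (g t) * height (g t) = 1 + fibre_norm2 (g t)) by (apply sqrt_sqrt; lra).
      assert (Hh0 : 0 < height (g t)) by (apply sqrt_lt_R0; lra).
      unfold scal; simpl; unfold mult; simpl.
      assert (HN : 0 <= N (g t) (dg t)). { apply metric_norm2_ge_0. exact Hp.
      now apply Rlt_le, hfpos. lra. }
      assert (Hb := fibre_norm2_derive_bound (g t) (dg t) Hp). fold (d t) in Hb.
      rewrite <- sqrt_mult_alt.
      apply le_sqrt_of_sqr_le.
      apply (Rmult_le_reg_r (4 * (height (g t) * height (g t)))). nra.
      replace (d t / (2 * height (g t)) * (d t / (2 * height (g t))) * (4 * (height (g t)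
        * height (g t)))) with (d t ^ 2) by (field; lra).
      eapply Rle_trans. exact Hb. rewrite Hh.
      assert (HK := growth_constant_ge_0).
      assert (0 <= (/ c + B / m) * N (g t) (dg t)) by now apply Rmult_le_pos.
      lra. apply growth_constant_ge_0.
    - apply (continuous_scal_r (V := R_NormedModule)). now apply continuous_speed. }
  rewrite (RInt_scal (V := R_CompleteNormedModule)) in H by now apply ex_RInt_speed.
  unfold scal in H; simpl in H; unfold mult in H; simpl in H. lra.
Qed.

Lemma height_joined p q l :
  joined (omega n alpha s f c) p q l -> height q <= height p + sqrt (/ c + B / m) * l.
Proof.
  induction 1 as [p Hp|g dg q l Hg H IH]. lra.
  assert (H1 := height_arc g dg Hg). lra.
Qed.

End Metric.

(** * Straight segments: coordinate convergence implies convergence in distance *)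

Definition segment (y p : C * C) (t : R) : C * C :=
  ((fst y + RtoC t * (fst p - fst y))%C, (snd y + RtoC t * (snd p - snd y))%C).

Lemma is_cderive_affine (a b : C) (t : R) : is_cderive (fun t => a + RtoC t * b)%C t b.
Proof.
  apply is_cderive_iff; split; unfold Re, Im; simpl; auto_derive; trivial; ring.
Qed.

Lemma segment_derive y p t :
  is_derive (V := RC2) (segment y p) t ((fst p - fst y)%C, (snd p - snd y)%C).
Proof. apply is_derive_C2_iff; split; apply is_cderive_affine. Qed.

(** Balls of the product structure are boxes, so convexity is checked on each of the four real
    coordinates. *)
Lemma segment_ball y p (d : posreal) t :
  ball (M := C2U) p d y -> 0 <= t <= 1 -> ball (M := C2U) p d (segment y p t).
Proof.
  assert (H : forall a b : R, ball a d b -> 0 <= t <= 1 -> ball a d (b + t * (a - b))).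
  { intros a b Hb Ht. unfold ball in *; simpl in *; unfold AbsRing_ball, abs, minus, plus,
      opp in *; simpl in *.
    replace (b + t * (a - b) + - a) with ((1 - t) * (b + - a)) by ring.
    rewrite Rabs_mult, (Rabs_pos_eq (1 - t)) by lra.
    apply Rle_lt_trans with (1 * Rabs (b + - a)); [|lra].
    apply Rmult_le_compat_r. apply Rabs_pos. lra. }
  destruct y as [[y1 y2] [y3 y4]], p as [[p1 p2] [p3 p4]].
  intros [[H1 H2] [H3 H4]] Ht. simpl in H1, H2, H3, H4.
  unfold segment; simpl.
  split; split; simpl.
  - replace (y1 + _) with (y1 + t * (p1 - y1)) by ring. now apply H.
  - replace (y2 + _) with (y2 + t * (p2 - y2)) by ring. now apply H.
  - replace (y3 + _) with (y3 + t * (p3 - y3)) by ring. now apply H.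
  - replace (y4 + _) with (y4 + t * (p4 - y4)) by ring. now apply H.
Qed.

Lemma difference_ball y p (d : posreal) :
  ball (M := C2U) p d y ->
  ball (M := C2U) (RtoC 0, RtoC 0) d ((fst p - fst y)%C, (snd p - snd y)%C).
Proof.
  assert (H : forall a b : R, ball a d b -> ball 0 d (a + - b)).
  { intros a b Hb. unfold ball in *; simpl in *; unfold AbsRing_ball, abs, minus, plus, opp in *;
      simpl in *.
    replace (a + - b + - 0) with (- (b + - a)) by ring. now rewrite Rabs_Ropp. }
  destruct y as [[y1 y2] [y3 y4]], p as [[p1 p2] [p3 p4]].
  intros [[H1 H2] [H3 H4]]. split; split; simpl; now apply H.
Qed.

Section Paths.
Variables (n : nat) (alpha : C) (s : C -> C) (f : C * C -> R) (c : R).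
Hypothesis hs : smooth_on (V := C_NormedModule) Cstar s.
Hypothesis hf : forall p, cover p -> continuous (T := C2U) f p.
Hypothesis hfpos : forall p, cover p -> 0 < f p.
Hypothesis hc : 0 < c.

Let om := omega n alpha s f c.
Let N := metric_norm2 n alpha s f c.

(** The squared norm is continuous in point and vector and vanishes at the zero vector, so it is
    below [(eps/2)^2] near [(p, 0)]. A segment from a nearby [y] has the small constant velocity
    [p - y], hence length at most [eps/2]. *)
Lemma short_segment p eps :
  cover p -> 0 < eps ->
  exists d : posreal, forall y, ball (M := C2U) p d y -> exists l, l < eps /\ joined om y p l.
Proof.
  intros Hp Heps.
  assert (Hc : continuous (T := prod_UniformSpace C2U C2U) (fun y => N (fst y) (snd y)) (p,
    (RtoC 0, RtoC 0))).
  { apply continuous_metric_norm2; trivial. apply (continuous_fst (U := C2U) (V := C2U)).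
    apply (continuous_snd (U := C2U) (V := C2U)). }
  assert (N0 : N p (RtoC 0, RtoC 0) = 0).
  { unfold N, metric_norm2. rewrite eta_fold. unfold zeta, dz; simpl fst; simpl snd.
    replace (0 / fst p)%C with (RtoC 0) by (unfold Cdiv; ring).
    replace (0 + _)%C with (RtoC 0) by ring. rewrite Cmod_0. simpl. ring. }
  destruct (Hc (fun r => r < (eps / 2) ^ 2)) as [d1 Hd1].
  { cbv beta. simpl fst; simpl snd. rewrite N0. apply open_lt. apply pow_lt. lra. }
  destruct (open_cover p Hp) as [d2 Hd2].
  exists (mkposreal _ (Rmin_stable_in_posreal d1 d2)). intros y Hy.
  set (g := segment y p). set (dg := fun _ : R => ((fst p - fst y)%C, (snd p - snd y)%C)).
  assert (Hin : forall t, 0 <= t <= 1 -> ball (M := C2U) p d1 (g t) /\ cover (g t)).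
  { intros t Ht. assert (H := segment_ball y p _ t Hy Ht). split.
    eapply ball_le; [|exact H]. apply Rmin_l.
    apply Hd2. apply (ball_le (M := C2U) p (Rmin d1 d2)). apply Rmin_r. exact H. }
  assert (Hg : C1_arc g dg).
  { split; [|split]. apply segment_derive. intros t; apply continuous_const. apply Hin. }
  exists (arc_length om g dg + 0). split.
  - rewrite Rplus_0_r. unfold om. rewrite arc_length_eq.
    apply Rle_lt_trans with (RInt (fun _ => eps / 2) 0 1).
    + apply RInt_le. lra. now apply ex_RInt_speed. apply ex_RInt_const.
      intros t Ht. rewrite <- (sqrt_pow2 (eps / 2)) by lra. apply sqrt_le_1_alt, Rlt_le.
      apply (Hd1 (g t, dg t)). split. apply Hin; lra.
      apply (ball_le (M := C2U) _ (Rmin d1 d2)). apply Rmin_l. exact (difference_ball y p _ Hy).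
    + rewrite RInt_const. unfold scal; simpl; unfold mult; simpl. lra.
  - assert (E0 : g 0 = y). { unfold g, segment. destruct y; simpl. f_equal; ring. }
    assert (E1 : g 1 = p). { unfold g, segment. destruct p; simpl. f_equal; ring. }
    rewrite <- E0. apply joined_step. exact Hg. rewrite E1. now apply joined_refl.
Qed.

Lemma joined_trans p q r l l' : joined om p q l -> joined om q r l' -> joined om p r (l + l').
Proof.
  intros H1 H2. induction H1 as [p Hp|g dg q l Hg H IH]. now rewrite Rplus_0_l.
  rewrite Rplus_assoc. apply joined_step; auto.
Qed.

Lemma joined_cover p q l : joined om p q l -> cover p /\ cover q.
Proof.
  induction 1 as [p Hp|g dg q l Hg H IH]. easy. split. apply Hg; lra. apply IH.
Qed.

(** * Action of the deck transformation on curves and orbits *)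

Variable P : C -> C.
Hypothesis halpha : 0 < Cmod alpha < 1.
Hypothesis hP : polynomial_of_degree_at_most n P.
Hypothesis hsF : forall z : C, Cstar z -> s (alpha * z)%C = (z ^ n * s z - P z)%C.
Let F := deck n alpha P.
Hypothesis hfF : forall p, cover p -> f (F p) = f p.

Lemma arc_deck g dg :
  C1_arc g dg ->
  exists dg', C1_arc (fun t => F (g t)) dg' /\ arc_length om (fun t => F (g t))
    dg' = arc_length om g dg.
Proof.
  intros Hg. destruct (polynomial_holo_derive n P hP) as [P' [HP' HP]].
  assert (Hgt : forall t, continuous (U := C2U) g t) by (intros;
    now apply C1_arc_continuous with dg).
  exists (fun t => deck_differential n alpha (P' (fst (g t))) (g t) (dg t)).
  destruct Hg as [Hd [Hdc Hcov]].
  split; [split; [|split]|].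
  - intros t. destruct (proj1 (is_derive_C2_iff _ _ _) (Hd t)) as [H1 H2].
    apply is_derive_C2_iff; split.
    + change (is_cderive (fun x => alpha * fst (g x))%C t (alpha * fst (dg t))%C).
      apply (is_cderive_eq _ _ (0 * fst (g t) + alpha * fst (dg t))%C); [|ring].
      apply (is_cderive_mult (fun _ => alpha)). apply is_cderive_const. exact H1.
    + change (is_cderive (fun x => fst (g x) ^ n * snd (g x) + P (fst (g x)))%C t
        (fst (dg t) * (RtoC (INR n) * fst (g t) ^ pred n) * snd (g t) + fst (g t) ^ n * snd (dg t)
          + fst (dg t) * P' (fst (g t)))%C).
      apply is_cderive_plus. apply (is_cderive_mult (fun x => fst (g x) ^ n)%C).
      exact (is_holo_derive_pow n (fst (g t)) (fun x => fst (g x)) t _ eq_refl H1). exact H2.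
      exact (HP (fst (g t)) (fun x => fst (g x)) t _ eq_refl H1).
  - intros t. specialize (Hgt t). specialize (Hdc t).
    assert (H1 := continuous_C2_fst _ _ Hgt). assert (H2 := continuous_C2_snd _ _ Hgt).
    assert (H3 := continuous_C2_fst _ _ Hdc). assert (H4 := continuous_C2_snd _ _ Hdc).
    apply continuous_C2_pair; unfold deck_differential; cbn [fst snd].
    + apply continuous_Cmult. apply continuous_const. exact H3.
    + assert (H5 := continuous_Cpow _ n _ H1). assert (H6 := continuous_Cpow _ (pred n) _ H1).
      assert (H7 : continuous (fun t => P' (fst (g t))) t).
      { apply (continuous_comp (fun t => fst (g t)) P'). exact H1. apply HP'. }
      apply continuous_Cplus; [apply continuous_Cplus |]; (apply continuous_Cmult; [|assumption]).
      * apply continuous_Cmult. exact H3. apply continuous_Cmult. apply continuous_const. exact H6.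
      * exact H5.
      * exact H3.
  - intros t Ht. apply deck_cover; auto.
  - unfold om, arc_length. apply RInt_ext. intros t Ht. rewrite Rmin_left, Rmax_right in Ht by lra.
    do 2 f_equal.
    (* The differential of [F] is complex linear, hence commutes with [I]. *)
    replace (mulI (deck_differential n alpha (P' (fst (g t))) (g t) (dg t))) with
     (deck_differential n alpha (P' (fst (g t))) (g t) (mulI (dg t))).
    apply (omega_deck n alpha P s); auto. apply Hcov; lra. apply hfF, Hcov; lra.
    unfold deck_differential, mulI; cbn [fst snd]. f_equal; ring.
Qed.

Lemma joined_deck p q l : joined om p q l -> joined om (F p) (F q) l.
Proof.
  induction 1 as [p Hp|g dg q l Hg H IH].
  - apply joined_refl. now apply deck_cover.
  - destruct (arc_deck g dg Hg) as [dg' [H1 H2]]. rewrite <- H2.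
    apply (joined_step om (fun t => F (g t))); assumption.
Qed.

Lemma joined_iter_deck k p q l : joined om p q l -> joined om (Nat.iter k F p) (Nat.iter k F q) l.
Proof. intros H. induction k as [|k IH]. exact H. now apply joined_deck. Qed.

Lemma iter_deck_cover k p : cover p -> cover (Nat.iter k F p).
Proof. intros H. induction k as [|k IH]. exact H. now apply deck_cover. Qed.

Lemma deck_inj p q : cover p -> cover q -> F p = F q -> p = q.
Proof.
  intros Hp Hq E. unfold F, deck in E. destruct p as [z w], q as [z' w']; simpl in *.
  injection E as E1 E2.
  assert (Ez : z = z').
  { replace z with (alpha * z / alpha)%C by (field; exact (alpha_neq_0 alpha halpha)).
    unfold cover in *; simpl in *.
    assert (E : (alpha * z)%C = (alpha * z')%C) by (apply injective_projections; assumption).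
    rewrite E. field. exact (alpha_neq_0 alpha halpha). }
  subst z'. f_equal.
  assert (Hz : (z ^ n)%C <> 0) by now apply Cpow_nz.
  assert (E : (z ^ n * w + P z)%C = (z ^ n * w' + P z)%C) by (apply injective_projections;
    assumption).
  replace w with ((z ^ n * w + P z - P z) / z ^ n)%C by (field; exact Hz).
  rewrite E. field. exact Hz.
Qed.

Lemma iter_deck_inj k p q : cover p -> cover q -> Nat.iter k F p = Nat.iter k F q -> p = q.
Proof.
  intros Hp Hq. induction k as [|k IH]; simpl. easy.
  intros E. apply IH. apply deck_inj; trivial; now apply iter_deck_cover.
Qed.

Lemma same_orbit_sym p q : same_orbit F p q -> same_orbit F q p.
Proof. intros [k [H|H]]; exists k; auto. Qed.

Lemma same_orbit_iter k p : same_orbit F p (Nat.iter k F p).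
Proof. exists k; now left. Qed.

(** [same_orbit] uses only forward iterates. When [p] and [r] have the common image [q], the smaller
    exponent is cancelled by injectivity of [F]; when both are images of [q], the exponents are
    subtracted. *)
Lemma same_orbit_trans p q r :
  cover p -> cover q -> cover r -> same_orbit F p q -> same_orbit F q r -> same_orbit F p r.
Proof.
  intros Hp Hq Hr [k Hk] [j Hj]. destruct Hk as [Hk|Hk], Hj as [Hj|Hj].
  - subst. exists (j + k)%nat. left. now rewrite Nat.iter_add.
  - subst q. destruct (Nat.le_ge_cases j k) as [H|H].
    + exists (k - j)%nat. left. apply (iter_deck_inj j); trivial. now apply iter_deck_cover.
      rewrite <- Nat.iter_add, Hj. f_equal. now rewrite Nat.add_comm, Nat.sub_add.
    + exists (j - k)%nat. right. apply (iter_deck_inj k); trivial. now apply iter_deck_cover.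
      rewrite <- Nat.iter_add, <- Hj. f_equal. now rewrite Nat.add_comm, Nat.sub_add.
  - subst p r. destruct (Nat.le_ge_cases k j) as [H|H].
    + exists (j - k)%nat. left. rewrite <- Nat.iter_add. now rewrite Nat.sub_add.
    + exists (k - j)%nat. right. rewrite <- Nat.iter_add. now rewrite Nat.sub_add.
  - subst. exists (k + j)%nat. right. now rewrite Nat.iter_add.
Qed.

Lemma same_orbit_invariant {X : Type} (h : C * C -> X) p q :
  (forall p, cover p -> h (F p) = h p) -> cover p -> cover q -> same_orbit F p q -> h p = h q.
Proof.
  intros Hh Hp Hq.
  assert (H : forall k p, cover p -> h (Nat.iter k F p) = h p).
  { intros k r Hr. induction k as [|k IH]; simpl. easy. rewrite Hh. exact IH.
    now apply iter_deck_cover. }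
  intros [k [<-|<-]]; rewrite H; auto.
Qed.

End Paths.

(** * Completeness *)

(* [k <= phi k] is weaker than monotonicity of [phi], but enough to pass to limits. *)
Lemma bounded_subsequence (u : nat -> R) (M : R) :
  (forall k, Rabs (u k) <= M) ->
  exists (phi : nat -> nat) (l : R), (forall k,
    (k <= phi k)%nat) /\ is_lim_seq (fun k => u (phi k)) l.
Proof.
  intros Hu.
  destruct (Bolzano_Weierstrass u (fun x => - M <= x <= M)) as [l Hl].
  - apply compact_P3.
  - intros k. apply Rabs_le_between, Hu.
  - assert (H : forall k, exists p, (k <= p)%nat /\ Rabs (u p - l) < / (INR k + 1)).
    { intros k. assert (Hk : 0 < / (INR k + 1)) by (apply Rinv_0_lt_compat; pose proof (pos_INR k);
        lra).
      destruct (Hl (fun x => Rabs (x - l) < / (INR k + 1)) k) as [p [Hp1 Hp2]].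
      - exists (mkposreal _ Hk). intros x Hx. exact Hx.
      - now exists p. }
    apply choice in H. destruct H as [phi Hphi].
    exists phi, l. split. apply Hphi.
    apply is_lim_seq_spec. intros eps.
    destruct (archimed_cor1 eps (cond_pos eps)) as [k0 [Hk1 Hk2]].
    exists k0. intros k Hk. eapply Rlt_trans. apply Hphi.
    eapply Rle_lt_trans; [|exact Hk1].
    apply Rinv_le_contravar. now apply lt_0_INR. apply le_INR in Hk. lra.
Qed.

Lemma is_lim_seq_reindex (u : nat -> R) l (psi : nat -> nat) :
  (forall k, (k <= psi k)%nat) -> is_lim_seq u l -> is_lim_seq (fun k => u (psi k)) l.
Proof.
  intros Hpsi. apply is_lim_seq_subseq. intros Q [k0 Hk0]. exists k0. intros k Hk.
  apply Hk0. specialize (Hpsi k). lia.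
Qed.

Lemma seq_continuous_C (u : nat -> C) (l : C) :
  is_lim_seq (fun k => Re (u k)) (Re l) -> is_lim_seq (fun k => Im (u k)) (Im l) ->
  filterlim u eventually (locally l).
Proof.
  intros H1 H2 Q [eps HQ].
  destruct (H1 (ball (Re l) eps)) as [k1 Hk1]. now exists eps.
  destruct (H2 (ball (Im l) eps)) as [k2 Hk2]. now exists eps.
  exists (max k1 k2). intros k Hk. apply HQ. split. apply Hk1; lia. apply Hk2; lia.
Qed.

Lemma bounded_subsequence_C (u : nat -> C) (M : R) :
  (forall k, Cmod (u k) <= M) ->
  exists (phi : nat -> nat) (l : C), (forall k, (k <= phi k)%nat) /\
    filterlim (fun k => u (phi k)) eventually (locally l).
Proof.
  intros Hu.
  destruct (bounded_subsequence (fun k => Re (u k)) M) as [phi [a [Hphi Ha]]].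
  { intros k. eapply Rle_trans; [apply Rmax_l|]. eapply Rle_trans; [apply Rmax_Cmod | apply Hu]. }
  destruct (bounded_subsequence (fun k => Im (u (phi k))) M) as [psi [b [Hpsi Hb]]].
  { intros k. eapply Rle_trans; [apply Rmax_r|]. eapply Rle_trans; [apply Rmax_Cmod | apply Hu]. }
  exists (fun k => phi (psi k)), (a, b). split.
  - intros k. specialize (Hphi (psi k)). specialize (Hpsi k). lia.
  - apply seq_continuous_C; [|exact Hb].
    exact (is_lim_seq_reindex (fun k => Re (u (phi k))) a psi Hpsi Ha).
Qed.

Lemma filterlim_reindex {U : UniformSpace} (u : nat -> U) (l : U) (psi : nat -> nat) :
  (forall k, (k <= psi k)%nat) -> filterlim u eventually (locally l) ->
  filterlim (fun k => u (psi k)) eventually (locally l).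
Proof.
  intros Hpsi H Q HQ. destruct (H Q HQ) as [k0 Hk0]. exists k0. intros k Hk. apply Hk0.
  specialize (Hpsi k). lia.
Qed.

Lemma Cmod_lim_ge (u : nat -> C) (l : C) (r : R) :
  filterlim u eventually (locally l) -> (forall k, r <= Cmod (u k)) -> r <= Cmod l.
Proof.
  intros H Hr.
  assert (H1 : is_lim_seq (fun k => Cmod (u k)) (Cmod l)).
  { apply (filterlim_comp _ _ _ u Cmod _ (locally l)). exact H.
    apply (continuous_Cmod (fun x => x)). apply continuous_id. }
  exact (is_lim_seq_le (fun _ => r) _ r _ Hr (is_lim_seq_const r) H1).
Qed.

(** * The fundamental annulus of the elliptic curve *)

Section Annulus.
Variable alpha : C.
Hypothesis halpha : 0 < Cmod alpha < 1.

(** A closed fundamental domain for [z |-> alpha z], standing for the compactness of [E]. Both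
    boundary circles are kept; they are identified in [E]. *)
Definition annulus (z : C) : Prop := Cmod alpha <= Cmod z <= 1.

(** If [h] were unbounded, points with [h > k] would accumulate at some [l]. The lower bound on the
    modulus keeps [l] away from 0, so [h] is continuous at [l], a contradiction. *)
Lemma annulus_bounded (h : C -> R) :
  (forall z, Cstar z -> continuous h z) -> exists B, forall z, annulus z -> h z <= B.
Proof.
  intros Hh. apply NNPP. intros Hn.
  assert (H : forall k : nat, exists z, annulus z /\ INR k < h z).
  { intros k. apply NNPP. intros Hk. apply Hn. exists (INR k). intros z Hz.
    apply Rnot_lt_le. intros Hlt. apply Hk. now exists z. }
  apply choice in H. destruct H as [z Hz].
  destruct (bounded_subsequence_C z 1) as [phi [l [Hphi Hl]]]. { intros k. apply Hz. }
  assert (Hl0 : Cmod alpha <= Cmod l) by (apply (Cmod_lim_ge _ l _ Hl); intros; apply Hz).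
  assert (Hls : Cstar l). { intros E. rewrite E, Cmod_0 in Hl0. lra. }
  assert (Hlim : is_lim_seq (fun k => h (z (phi k))) (h l)).
  { apply (filterlim_comp _ _ _ _ h _ (locally l)). exact Hl. now apply Hh. }
  assert (Hinf : is_lim_seq (fun k => h (z (phi k))) p_infty).
  { apply is_lim_seq_le_p_loc with INR; [|apply is_lim_seq_INR].
    exists 0%nat. intros k _. apply Rlt_le. eapply Rle_lt_trans; [|apply Hz]. apply le_INR, Hphi. }
  apply is_lim_seq_unique in Hlim. apply is_lim_seq_unique in Hinf. congruence.
Qed.

(** Points outside the unit disc are multiplied by [alpha], the others divided by it, until they
    reach the annulus. The induction is on a bound for the number of moves, which exists because the
    powers of [|alpha|] tend to 0. *)
Lemma annulus_induction (Q : C -> Prop) :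
  (forall z, Cstar z -> Q (alpha * z)%C <-> Q z) -> (forall z, annulus z -> Q z) ->
  forall z, Cstar z -> Q z.
Proof.
  intros HQ HA.
  assert (Hd : forall k z, Cmod alpha <= Cmod z -> Cmod alpha ^ k * Cmod z <= 1 -> Q z).
  { induction k as [|k IH]; intros z Hz1 Hz2.
    - apply HA. split; simpl in Hz2; lra.
    - destruct (Rle_lt_dec (Cmod z) 1) as [H|H]. now apply HA.
      apply HQ. intros E. rewrite E, Cmod_0 in H. lra.
      apply IH; rewrite Cmod_mult.
      + rewrite <- (Rmult_1_r (Cmod alpha)) at 1. apply Rmult_le_compat_l; lra.
      + simpl in Hz2. lra. }
  (* With the exponent [S k], the case [k = 0] is exactly the annulus. *)
  assert (Hu : forall k z, Cmod z <= 1 -> Cmod alpha ^ S k <= Cmod z -> Q z).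
  { induction k as [|k IH]; intros z Hz1 Hz2.
    - apply HA. split; simpl in Hz2; lra.
    - destruct (Rle_lt_dec (Cmod alpha) (Cmod z)) as [H|H]. now apply HA.
      assert (Ha : alpha <> 0). { intros E. rewrite E, Cmod_0 in halpha. lra. }
      assert (Hz : 0 < Cmod z). { eapply Rlt_le_trans; [|exact Hz2]. apply pow_lt; lra. }
      replace z with (alpha * (z / alpha))%C by (field; exact Ha).
      apply HQ. apply Cmod_gt_0. rewrite Cmod_div by exact Ha. apply Rdiv_lt_0_compat; lra.
      apply IH; rewrite Cmod_div by exact Ha.
      apply (Rle_div_l _ _ _ (proj1 halpha)). lra.
      apply (Rle_div_r _ _ _ (proj1 halpha)). simpl in Hz2 |- *. lra. }
  intros z Hz. assert (Hz0 : 0 < Cmod z) by now apply Cmod_gt_0.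
  destruct (Rle_lt_dec (Cmod z) 1) as [H|H].
  - destruct (pow_lt_1_zero (Cmod alpha)) with (Cmod z) as [k Hk]. rewrite Rabs_pos_eq; lra. lra.
    apply (Hu k); trivial. specialize (Hk (S k)). rewrite Rabs_pos_eq in Hk by (apply pow_le; lra).
    apply Rlt_le, Hk. lia.
  - destruct (pow_lt_1_zero (Cmod alpha)) with (/ Cmod z) as [k Hk]. rewrite Rabs_pos_eq; lra.
    apply Rinv_0_lt_compat; lra.
    apply (Hd k); [lra|]. specialize (Hk k (le_n k)).
    rewrite Rabs_pos_eq in Hk by (apply pow_le; lra).
    apply Rmult_lt_compat_r with (r := Cmod z) in Hk; [|lra]. rewrite Rinv_l in Hk by lra. lra.
Qed.
End Annulus.

(** * Completeness of the quotient metric *)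

Lemma Glb_Rbar_lt (E : R -> Prop) (e : R) :
  Rbar_lt (Glb_Rbar E) e <-> exists l, E l /\ l < e.
Proof.
  destruct (Glb_Rbar_correct E) as [H1 H2]. split.
  - intros H. apply NNPP. intros Hn. apply (Rbar_lt_not_le _ _ H). apply H2.
    intros x Hx. simpl. apply Rnot_lt_le. intros Hlt. apply Hn. now exists x.
  - intros [l [Hl He]]. apply Rbar_le_lt_trans with l. now apply H1. exact He.
Qed.

Section Completeness.
Variables (n : nat) (alpha : C) (P s : C -> C) (f : C * C -> R) (c : R).
Hypothesis halpha : 0 < Cmod alpha < 1.
Hypothesis hP : polynomial_of_degree_at_most n P.
Hypothesis hs : smooth_on (V := C_NormedModule) Cstar s.
Hypothesis hsF : forall z : C, Cstar z -> s (alpha * z)%C = (z ^ n * s z - P z)%C.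
Let F := deck n alpha P.
Hypothesis hf : positive_smooth_on_A F f.
Hypothesis hc : 0 < c.
Let om := omega n alpha s f c.

(** Since [P] is holomorphic it drops out of the transformation rule of [ds/dz_bar]. The remaining
    factors [z^n] and [conj alpha] are balanced by the weight and by [|z|^2], so the function
    descends to [E]. *)
Lemma antiholomorphic_part_bounded :
  exists B, forall z, Cstar z -> weight n alpha z * Cmod (dz01 s z) ^ 2 * Cmod z ^ 2 <= B.
Proof.
  destruct (annulus_bounded alpha halpha (fun z => weight n alpha z * Cmod (dz01 s z)
    ^ 2 * Cmod z ^ 2)) as [B HB].
  - intros z Hz.
    apply continuous_Rmult. apply continuous_Rmult.
    + apply continuous_RtoC. exact (Ck_continuous (V := C_NormedModule)
        _ 0 _ _ (Ck_weight n alpha 0) Hz).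
    + apply continuous_Cmod_sqr. exact (Ck_continuous (V := C_NormedModule)
        _ 0 _ _ (smooth_dz01 s hs 0%nat) Hz).
    + apply (continuous_Cmod_sqr (fun z => z)), continuous_id.
  - exists B. apply (annulus_induction alpha halpha); [|exact HB].
    intros z Hz. destruct (polynomial_holo_derive n P hP) as [P' [_ HP]].
    destruct (s_alpha_wirtinger n alpha P s halpha hs hsF z (P' z) Hz (HP z)) as [_ H].
    assert (H1 : Cmod alpha * Cmod (dz01 s (alpha * z)%C) = Cmod (z ^ n) * Cmod (dz01 s z)).
    { rewrite <- (Cmod_conj alpha), <- !Cmod_mult. now rewrite H. }
    replace (weight n alpha (alpha * z)%C * Cmod (dz01 s (alpha * z)%C) ^ 2 * Cmod (alpha * z) ^ 2)
      with (weight n alpha z * Cmod (dz01 s z) ^ 2 * Cmod z ^ 2). tauto.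
    rewrite <- (weight_alpha n alpha halpha z Hz), Cmod_mult.
    transitivity (weight n alpha (alpha * z)%C * (Cmod (z ^ n) * Cmod (dz01 s z))
      ^ 2 * Cmod z ^ 2). ring.
    rewrite <- H1. ring.
Qed.

(** The property must hold for all [w] at once because [F] moves the fibre coordinate as well. A
    step backwards solves [z^n w' + P(z) = w], which is possible as [z] is nonzero. *)
Lemma annulus_representative p :
  cover p -> exists q, same_orbit F p q /\ cover q /\ annulus alpha (fst q).
Proof.
  destruct p as [z w]. intros Hz. change (Cstar z) in Hz. revert w.
  apply (annulus_induction alpha halpha (fun z => forall w, exists q, same_orbit F (z,
    w) q /\ cover q /\ annulus alpha (fst q))); trivial.
  - clear z Hz. intros z Hz.
    assert (Ha := alpha_neq_0 alpha halpha).
    assert (HF : forall w w', F (z, w) = ((alpha * z)%C, w') -> forall q, cover q ->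
      same_orbit F (z, w) q <-> same_orbit F ((alpha * z)%C, w') q).
    { intros w w' E q Hq.
      assert (H : same_orbit F (z, w) ((alpha * z)%C, w')) by (exists 1%nat; now left).
      assert (Hc1 : cover (z, w)) by exact Hz.
      assert (Hc2 : cover ((alpha * z)%C, w')) by now apply Cmult_neq_0.
      split; intros Ho; eapply (same_orbit_trans n alpha P halpha); try exact Ho; trivial.
      now apply same_orbit_sym. }
    split; intros H w.
    + destruct (H (z ^ n * w + P z)%C) as [q [H1 H2]]. exists q. split; [|exact H2].
      now apply (HF w _ eq_refl).
    + destruct (H ((w - P z) / z ^ n)%C) as [q [H1 H2]]. exists q. split; [|exact H2].
      eapply (HF ((w - P z) / z ^ n)%C); try exact H1; try easy.
      unfold F, deck; simpl. f_equal. field. now apply Cpow_nz.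
  - intros z' Hz' w. exists (z', w). split; [|split; [|exact Hz']].
    exists 0%nat; now left. intros E. unfold annulus in Hz'. simpl in E. rewrite E, Cmod_0 in Hz'.
    lra.
Qed.

Lemma fibre_norm2_deck p : cover p -> fibre_norm2 n alpha s (F p) = fibre_norm2 n alpha s p.
Proof.
  intros Hp. unfold fibre_norm2, F.
  rewrite (wtilde_deck n alpha P s hsF p Hp), Cmod_mult, <- (Lambda_deck n alpha P halpha p Hp).
  ring.
Qed.

(** Over the annulus [1 / Lambda] is at most [B1] and [|s|] at most [B2]; the bound for
    [w = wtilde - s] follows. *)
Lemma fibre_norm2_proper (R0 : R) :
  exists M, forall q, annulus alpha (fst q) -> fibre_norm2 n alpha s q <= R0 -> Cmod (snd q) <= M.
Proof.
  destruct (annulus_bounded alpha halpha (fun z => / weight n alpha z)) as [B1 H1].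
  { intros z Hz. apply (continuous_Rcomp Rinv _ _ (- / weight n alpha z ^ 2)).
    auto_derive. apply Rgt_not_eq, exp_pos. field. apply Rgt_not_eq, exp_pos.
    apply continuous_RtoC. exact (Ck_continuous (V := C_NormedModule) _ 0 _ _ (Ck_weight n alpha 0)
      Hz). }
  destruct (annulus_bounded alpha halpha (fun z => Cmod (s z))) as [B2 H2].
  { intros z Hz. apply continuous_Cmod. exact (Ck_continuous (V := C_NormedModule)
      _ 0 _ _ (hs 0%nat) Hz). }
  exists (sqrt (R0 * B1) + B2). intros q Hq HR.
  specialize (H1 _ Hq). specialize (H2 _ Hq). cbv beta in H1, H2.
  assert (Hw : 0 < weight n alpha (fst q)) by apply exp_pos.
  assert (H3 : Cmod (wtilde s q) <= sqrt (R0 * B1)).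
  { apply le_sqrt_of_sqr_le.
    assert (H0 := fibre_norm2_ge_0 n alpha s q).
    replace (Cmod (wtilde s q) * Cmod (wtilde s q))
      with (fibre_norm2 n alpha s q * / weight n alpha (fst q)).
    apply Rmult_le_compat; trivial. apply Rlt_le, Rinv_0_lt_compat, Hw.
    unfold fibre_norm2. change (Lambda n alpha q) with (weight n alpha (fst q)). field. lra. }
  replace (snd q) with (wtilde s q + - s (fst q))%C by (unfold wtilde; ring).
  eapply Rle_trans. apply Cmod_triangle. rewrite Cmod_opp. lra.
Qed.

Lemma omega_complete : Rbar_lt 0 (inf_A f) -> complete_on_A F om.
Proof.
  intros Hinf. destruct hf as [hf1 [hf2 hf3]].
  assert (hfc : forall p, cover p -> continuous (T := C2U) f p).
  { intros p Hp. apply continuous_RtoC. exact (Ck_continuous (V := V2) _ 0 _ _ (hf1 0%nat) Hp). }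
  assert (Hm : exists m, 0 < m /\ forall p, cover p -> m <= f p).
  { destruct (Glb_Rbar_correct (fun y => exists p, cover p /\ y = f p)) as [H1 _].
    fold (inf_A f) in H1. destruct (inf_A f) as [r| |]; simpl in Hinf; [| |easy].
    - exists r. split. exact Hinf. intros p Hp. apply (H1 (f p)). now exists p.
    (* An infinite infimum is contradicted by any value of [f], so the witness 1 is arbitrary. *)
    - exists 1. split. lra. intros p Hp. destruct (H1 (f p)). now exists p. }
  destruct Hm as [m [Hm0 Hm]]. destruct antiholomorphic_part_bounded as [B HB].
  intros x Hx Hcauchy.
  (* The radius 1 is arbitrary: it bounds the height from [N0] on by the height of [x N0] plus the
     Lipschitz constant [K]. *)
  destruct (Hcauchy 1 Rlt_0_1) as [N0 HN0].
  set (K := sqrt (/ c + B / m)).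
  set (H0 := height n alpha s (x N0) + K).
  assert (Hinv : forall p q, cover p -> cover q -> same_orbit F p q ->
    fibre_norm2 n alpha s p = fibre_norm2 n alpha s q).
  { intros p q Hp Hq. apply (same_orbit_invariant n alpha P halpha); trivial.
    apply fibre_norm2_deck. }
  assert (Hbound : forall k, fibre_norm2 n alpha s (x (N0 + k)%nat) <= H0 * H0).
  { intros k. destruct (proj1 (Glb_Rbar_lt _ _) (HN0 N0 (N0 + k)%nat (le_n _) (Nat.le_add_r _ _)))
      as [l [[p' [q' [Hp' [Hq' Hj]]]] Hl]].
    destruct (joined_cover _ _ _ _ _ _ _ _ Hj) as [Hcp Hcq].
    assert (H := height_joined n alpha s f c hs hfc hf2 hc m B Hm0 Hm HB p' q' l Hj). fold K in H.
    rewrite (Hinv _ q' (Hx _) Hcq Hq').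
    assert (HK : 0 <= K) by apply sqrt_pos.
    assert (H1 : height n alpha s p' = height n alpha s (x N0)).
    { unfold height. now rewrite (Hinv _ p' (Hx _) Hcp Hp'). }
    assert (H2 : height n alpha s q' <= H0). { unfold H0. rewrite <- H1. nra. }
    assert (H3 := fibre_norm2_ge_0 n alpha s q').
    assert (H4 : height n alpha s q' * height n alpha s q' = 1 + fibre_norm2 n alpha s q')
      by (apply sqrt_sqrt; lra).
    assert (H5 : 0 <= height n alpha s q') by apply sqrt_pos. nra. }
  destruct (fibre_norm2_proper (H0 * H0)) as [M HM].
  (* The points [x k] themselves may run off along their orbits; representatives over the annulus,
     where bounded height means bounded coordinates, stay in a compact set. *)
  assert (Hy : forall k, exists q, same_orbit F (x (N0 + k)%nat)
    q /\ cover q /\ annulus alpha (fst q)).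
  { intros k. now apply annulus_representative. }
  apply choice in Hy. destruct Hy as [y Hy].
  destruct (bounded_subsequence_C (fun k => fst (y k)) 1) as [phi [z [Hphi Hz]]].
  { intros k. apply Hy. }
  destruct (bounded_subsequence_C (fun k => snd (y (phi k))) M) as [psi [w [Hpsi Hw]]].
  { intros k. destruct (Hy (phi k)) as [Hy1 [Hy2 Hy3]]. apply HM. exact Hy3.
    rewrite <- (Hinv (x (N0 + phi k)%nat)); trivial. }
  assert (Hz' := filterlim_reindex (fun k => fst (y (phi k))) z psi Hpsi Hz). cbv beta in Hz'.
  assert (Hzs : cover (z, w)).
  { assert (H : Cmod alpha <= Cmod z). { apply (Cmod_lim_ge _ z _ Hz'). intros k. apply Hy. }
    intros E. simpl in E. rewrite E, Cmod_0 in H. lra. }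
  exists (z, w). split. exact Hzs. intros eps Heps.
  destruct (Hcauchy (eps / 2)) as [N1 HN1]. lra.
  destruct (short_segment n alpha s f c hs hfc hf2 hc (z, w) (eps / 2) Hzs) as [d Hd]. lra.
  destruct (Hz' (ball z d)) as [k1 Hk1]. now exists d.
  destruct (Hw (ball w d)) as [k2 Hk2]. now exists d.
  (* A single index beyond both thresholds: [N0 + j] lies in the Cauchy range, and [y j], in the
     orbit of [x (N0 + j)], is close to the limit. *)
  set (k0 := max N1 (max k1 k2)). set (j := phi (psi k0)).
  assert (Hj : (k0 <= j)%nat). { unfold j. specialize (Hphi (psi k0)). specialize (Hpsi k0). lia. }
  destruct (Hd (y j)) as [l' [Hl' Hj']]. { split. apply Hk1; lia. apply Hk2; lia. }
  exists N1. intros k Hk. apply Glb_Rbar_lt.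
  destruct (proj1 (Glb_Rbar_lt _ _) (HN1 k (N0 + j)%nat Hk ltac:(lia)))
      as [l [[p' [q' [Hp' [Hq' Hjo]]]] Hl]].
  destruct (joined_cover _ _ _ _ _ _ _ _ Hjo) as [Hcp Hcq].
  exists (l + l'). split; [|lra].
  destruct (Hy j) as [Hy1 [Hy2 _]].
  assert (Horb : same_orbit F q' (y j)).
  { apply (same_orbit_trans n alpha P halpha _ (x (N0 + j)%nat)); trivial.
    now apply same_orbit_sym. }
  (* The curve from the orbit of [x k] ends at [q'], while the short segment starts at [y j],
     possibly another point of the same orbit. An iterate of [F] moves whichever curve lies behind;
     its length is unchanged and its other end stays in its orbit. *)
  destruct Horb as [i [Hi|Hi]].
  - exists (Nat.iter i F p'), (z, w). split; [|split].
    + apply (same_orbit_trans n alpha P halpha _ p'); trivial. now apply iter_deck_cover.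
      apply same_orbit_iter.
    + exists 0%nat; now left.
    + apply joined_trans with (y j); [|exact Hj']. rewrite <- Hi.
      now apply joined_iter_deck.
  - exists p', (Nat.iter i F (z, w)). split; [|split]. exact Hp'. apply same_orbit_iter.
    apply joined_trans with q'. exact Hjo. rewrite <- Hi. now apply joined_iter_deck.
Qed.

End Completeness.

Theorem proposition1 (n : nat) (alpha : C) (P s : C -> C)
  (hn : (0 < n)%nat)
  (halpha : 0 < Cmod alpha < 1)
  (hP : polynomial_of_degree_at_most n P)
  (hs : smooth_on (V := C_NormedModule) Cstar s)
  (hsF : forall z : C, Cstar z -> s (alpha * z)%C = (z ^ n * s z - P z)%C) :
  (forall (f : C * C -> R) (c : R),
     positive_smooth_on_A (deck n alpha P) f -> 0 < c ->
     hermitian_metric_on_A (deck n alpha P) (omega n alpha s f c) /\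
     flat_along_leaves (omega n alpha s f c) /\
     (Rbar_lt 0 (inf_A f) -> complete_on_A (deck n alpha P) (omega n alpha s f c))) /\
  (forall a c : R, 0 < a -> 0 < c ->
     positive_smooth_on_A (deck n alpha P) (gauduchon_f n alpha s a c) /\
     gauduchon (omega n alpha s (gauduchon_f n alpha s a c) c)).
Proof.
  split.
  - intros f c Hf Hc. split; [|split].
    + now apply omega_hermitian.
    + now apply omega_flat.
    + now apply omega_complete.
  - intros a c Ha Hc. split.
    + now apply gauduchon_f_positive_smooth.
    + now apply gauduchon_omega.
Qed.
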